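(* Let $R=K[\underline{x}]$ be a polynomial ring over a field $K$ and let $\underline{\alpha}=\alpha_1,\ldots,\alpha_g$ be a homogeneous regular sequence in $R$, with each $\alpha_i$ of the same degree. If the pair $(R,\underline{\alpha})$ has the property $\mathbf{P}$, then for each $s\geq g$ the pair $(R[Y],\operatorname{RI}(s;\underline{\alpha}))$ also has the property $\mathbf{P}$, where $Y$ is an $s\times g$ matrix of indeterminates and $$\operatorname{RI}(s;\underline{\alpha})=Y[\alpha_1\cdots\alpha_g]^TR[Y]:(\underline{\alpha})R[Y]$$ is the generic $s$-residual intersection of the ideal $(\underline{\alpha})$.
   Context: Property $\mathbf{P}$: Let $R$ be a polynomial ring over a field and $I$ an unmixed homogeneous ideal (all associated primes of the same height). The pair $(R,I)$ has $\mathbf{P}$ if, for some fixed term order $<$ on $R$, there exist homogeneous elements $\alpha_1,\ldots,\alpha_{\operatorname{ht}(I)}$ in $I$ (where $\operatorname{ht}$ denotes height) such that each initial term $\operatorname{in}_<(\alpha_i)$ is squarefree and $\operatorname{in}_<(\alpha_i),\operatorname{in}_<(\alpha_j)$ are coprime for all $i\neq j$. For a homogeneous regular sequence $\underline{\alpha}=\alpha_1,\ldots,\alpha_g$, ''the pair $(R,\underline{\alpha})$ has $\mathbf{P}$'' means that the elements $\alpha_1,\ldots,\alpha_g$ themselves have squarefree, pairwise coprime initial terms with respect to some term order on $R$, i.e. they are elements witnessing $\mathbf{P}$ for the ideal $(\underline{\alpha})$. $Y[\alpha_1\cdots\alpha_g]^TR[Y]$ denotes the ideal of $R[Y]$ generated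 by the $s$ entries of the column vector $Y[\alpha_1\cdots\alpha_g]^T$. *)

(* Defs.v *)
(* MathComp, with multinomials' [{mpoly K[n]}] for K[x_1, ..., x_n]. *)
From HB Require Import structures.
From mathcomp Require Import all_boot all_order all_algebra.
From mathcomp Require Import mpoly.

Set Implicit Arguments.
Unset Strict Implicit.
Unset Printing Implicit Defensive.

Import GRing.Theory.
Local Open Scope ring_scope.

(* Ideals are Prop-valued predicates, possibly the whole ring; [idealr] of
   ring_quotient only covers proper ideals with decidable membership. *)
Section Ideals.
Variable R : comNzRingType.
Implicit Types I J P : R -> Prop.

Definition is_ideal I : Prop :=
  [/\ I 0, forall x y, I x -> I y -> I (x + y) & forall a x, I x -> I (a * x)].

Definition ideal_sub I J : Prop := forall x, I x -> J x.

Definition ideal_gen (T : finType) (A : pred T) (f : T -> R) : R -> Prop :=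
  fun x => exists c : T -> R, x = \sum_(i | A i) c i * f i.

Definition colon I J : R -> Prop := fun x => forall y, J y -> I (x * y).

Definition is_prime P : Prop :=
  [/\ is_ideal P, ~ P 1 & forall x y, P (x * y) -> P x \/ P y].

Definition associated_prime I P : Prop :=
  is_prime P /\ exists f, forall x, P x <-> I (x * f).

(* P is the top of a strict chain P_0 < P_1 < ... < P_h = P of primes. *)
Definition prime_chain P (h : nat) : Prop :=
  exists Q : nat -> R -> Prop,
    [/\ forall i, (i <= h)%N -> is_prime (Q i),
        forall i, (i < h)%N -> ideal_sub (Q i) (Q i.+1)
                               /\ ~ ideal_sub (Q i.+1) (Q i)
      & forall x, Q h x <-> P x].

Definition prime_height P (h : nat) : Prop :=
  prime_chain P h /\ forall k, prime_chain P k -> (k <= h)%N.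

(* h is the minimum of the heights of the primes containing I.  Having a chain
   of length h means having height at least h (infinite height included).  No
   h is the height of the unit ideal. *)
Definition ideal_height I (h : nat) : Prop :=
  (exists P, [/\ is_prime P, ideal_sub I P & prime_height P h])
  /\ (forall P, is_prime P -> ideal_sub I P -> prime_chain P h).

Definition unmixed I : Prop :=
  exists h, forall P, associated_prime I P -> prime_height P h.

Definition regular_sequence (g : nat) (a : 'I_g -> R) : Prop :=
  ~ ideal_gen predT a 1
  /\ forall (i : 'I_g) x,
       ideal_gen (fun j : 'I_g => (j < i)%N) a (x * a i) ->
       ideal_gen (fun j : 'I_g => (j < i)%N) a x.

End Ideals.

Definition homogeneous_ideal (n : nat) (K : fieldType)
    (I : {mpoly K[n]} -> Prop) : Prop :=
  forall p, I p -> forall d, I (pihomog mdeg d p).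

Definition term_order (n : nat) (le : rel 'X_{1..n}) : Prop :=
  [/\ total le, antisymmetric le, transitive le,
      forall m, le 0%MM m
    & forall m1 m2 m, le m1 m2 -> le (m1 + m)%MM (m2 + m)%MM].

(* The zero polynomial has no initial monomial. *)
Definition is_initial (n : nat) (K : fieldType) (le : rel 'X_{1..n})
    (p : {mpoly K[n]}) (m : 'X_{1..n}) : Prop :=
  m \in msupp p /\ forall m', m' \in msupp p -> le m' m.

Definition squarefree_mnm (n : nat) (m : 'X_{1..n}) : Prop :=
  forall k, (m k <= 1)%N.

Definition coprime_mnm (n : nat) (m1 m2 : 'X_{1..n}) : Prop :=
  forall k, m1 k = 0%N \/ m2 k = 0%N.

Definition sqfree_coprime_initials (n : nat) (K : fieldType)
    (le : rel 'X_{1..n}) (g : nat) (a : 'I_g -> {mpoly K[n]}) : Prop :=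
  exists m : 'I_g -> 'X_{1..n},
    [/\ forall i, is_initial le (a i) (m i),
        forall i, squarefree_mnm (m i)
      & forall i j, i != j -> coprime_mnm (m i) (m j)].

(* Property P of a pair (R, I); being an unmixed homogeneous ideal is part of
   it. *)
Definition property_P (n : nat) (K : fieldType) (I : {mpoly K[n]} -> Prop) :
    Prop :=
  [/\ is_ideal I, homogeneous_ideal I, unmixed I
    & exists le : rel 'X_{1..n}, term_order le /\
      exists h : nat, ideal_height I h /\
      exists a : 'I_h -> {mpoly K[n]},
        [/\ forall i, I (a i),
            forall i, exists d, a i \is d.-homog
          & sqfree_coprime_initials le a]].

(* Property P of a pair (R, alpha) for a sequence alpha. *)
Definition property_P_seq (n : nat) (K : fieldType) (g : nat)
    (a : 'I_g -> {mpoly K[n]}) : Prop :=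
  exists le : rel 'X_{1..n}, term_order le /\ sqfree_coprime_initials le a.

(* R[Y] is K[x, Y] in n + s * g variables: the first n are the x_i, the other
   ones are the entries of the s x g matrix Y. *)
Section GenericResidual.
Variables (n : nat) (K : fieldType) (s g : nat).

Definition to_RY (p : {mpoly K[n]}) : {mpoly K[n + s * g]} :=
  p \mPo [tuple 'X_(lshift (s * g) i) | i < n].

Definition Ymx : 'M[{mpoly K[n + s * g]}]_(s, g) :=
  \matrix_(i < s, j < g) 'X_(rshift n (mxvec_index i j)).

Variable alpha : 'I_g -> {mpoly K[n]}.

Definition Yalpha : 'cV[{mpoly K[n + s * g]}]_s :=
  Ymx *m \col_(j < g) to_RY (alpha j).

Definition generic_RI : {mpoly K[n + s * g]} -> Prop :=
  colon (ideal_gen predT (fun i : 'I_s => Yalpha i 0))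
        (ideal_gen predT (fun j : 'I_g => to_RY (alpha j))).

End GenericResidual.

Arguments generic_RI {n K} s {g} alpha.

(* Main.v *)
From HB Require Import structures.
Require Import Defs.
From mathcomp Require Import all_boot all_order all_fingroup all_algebra.
From mathcomp Require Import mpoly ring zify.
From Stdlib Require Import Classical.

Set Implicit Arguments.
Unset Strict Implicit.
Unset Printing Implicit Defensive.

Import Order.TTheory GRing.Theory.
Local Open Scope ring_scope.

(* Write [l_i] for the entries of [Y alpha]; then [RI = (l) : (alpha)].

   [RI] is prime of height [s].  Solving [l_i = 0] for [Y_i1] over
   [R[1/alpha_1]] shows that the ideals
   [Q_k = {f | alpha_1^e f in (l_1, ..., l_k) for some e}] are prime; they form
   a chain of length [s].  The other [n + s g - s] variables are algebraically
   independent modulo [Q_s], and a strict inclusion of primes of a polynomial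
   ring lowers the transcendence degree, so [Q_s] has height [s].

   The point is [RI = Q_s]: if [f in (alpha)] is killed modulo [(l)] by powers of
   all the [alpha_j], then [f in (l)].  Add the rows of [Y] one at a time,
   and the variables of the new row [l = sum_j u_j alpha_j] one at a time.
   Setting the last variable [u] to [0] reduces to fewer variables, and since
   [u] is a nonzerodivisor modulo the torsion, graded Nakayama lifts the
   conclusion.  With a single variable, [l = u_r alpha_r] modulo
   [alpha_1, ..., alpha_(r-1)], and the claim for the previous rows modulo
   [alpha_1, ..., alpha_r] applies.  So the induction has to run modulo
   [alpha_1, ..., alpha_r] for all [r] at once.

   For the initial terms, order the monomials first by a weight for which
   [Y_(i,i+1)] is the heaviest variable of row [i] and the diagonal is the
   heaviest term of each minor.  The witnesses are [l_1, ..., l_(g-1)], with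
   initial terms [Y_(i,i+1) in(alpha_(i+1))], and the [s - g + 1] maximal minors
   on consecutive rows, with initial terms the disjoint diagonals
   [Y_(k,1) Y_(k+1,2) ... Y_(k+g-1,g)]. *)

(** * Ideals and elimination of a variable *)

Section Adjoin.
Variable R : comNzRingType.
Implicit Types (A B : R -> Prop) (f : nat -> R).

Definition adjoin A p : R -> Prop := fun x => exists a c, A a /\ x = a + c * p.

(** The sequence is indexed by [nat] so that generators are added one at a time by recursion;
    [ideal_gen_adjoins] translates back to [ideal_gen]. *)
Fixpoint adjoins A f k : R -> Prop :=
  if k is k'.+1 then adjoin (adjoins A f k') (f k') else A.

Lemma in_ideal0 A : is_ideal A -> A 0. Proof. by case. Qed.

Lemma in_idealD A x y : is_ideal A -> A x -> A y -> A (x + y).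
Proof. by case=> _ h _; apply: h. Qed.

Lemma in_idealM A a x : is_ideal A -> A x -> A (a * x).
Proof. by case=> _ _ h; apply: h. Qed.

Lemma in_idealMr A a x : is_ideal A -> A x -> A (x * a).
Proof. by rewrite mulrC; apply: in_idealM. Qed.

Lemma in_idealN A x : is_ideal A -> A x -> A (- x).
Proof. by rewrite -mulN1r; apply: in_idealM. Qed.

Lemma in_idealB A x y : is_ideal A -> A x -> A y -> A (x - y).
Proof. by move=> iA Ax Ay; apply: in_idealD => //; apply: in_idealN. Qed.

Lemma in_idealXM A x y k l :
  is_ideal A -> (k <= l)%N -> A (x ^+ k * y) -> A (x ^+ l * y).
Proof.
by move=> iA le_kl; rewrite -(subnK le_kl) exprD -mulrA; apply: in_idealM.
Qed.

Lemma ideal_sum (I : Type) (r : seq I) (P : pred I) (F : I -> R) A :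
  is_ideal A -> (forall i, P i -> A (F i)) -> A (\sum_(i <- r | P i) F i).
Proof.
move=> iA AF; elim/big_ind: _ => //; first exact: in_ideal0.
by move=> x y; apply: in_idealD.
Qed.

Lemma zero_ideal : is_ideal (fun x : R => x = 0).
Proof. by split=> // [x y -> ->|a x ->]; rewrite ?addr0 ?mulr0. Qed.

Lemma adjoin_ideal A p : is_ideal A -> is_ideal (adjoin A p).
Proof.
move=> iA; split.
- by exists 0, 0; split; [exact: in_ideal0 | ring].
- move=> x y [a [c [Aa ->]]] [a' [c' [Aa' ->]]].
  by exists (a + a'), (c + c'); split; [exact: in_idealD | ring].
- move=> z x [a [c [Aa ->]]].
  by exists (z * a), (z * c); split; [exact: in_idealM | ring].
Qed.

Lemma adjoin_sub A p x : A x -> adjoin A p x.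
Proof. by move=> Ax; exists x, 0; split=> //; ring. Qed.

Lemma adjoinM A p c : is_ideal A -> adjoin A p (c * p).
Proof. by move=> iA; exists 0, c; split; [exact: in_ideal0 | ring]. Qed.

Lemma adjoinS A B p x : (forall y, A y -> B y) -> adjoin A p x -> adjoin B p x.
Proof. by move=> sAB [a [c [Aa ->]]]; exists a, c; split=> //; apply: sAB. Qed.

Lemma adjoinC A p q x : adjoin (adjoin A p) q x -> adjoin (adjoin A q) p x.
Proof.
move=> [_ [c [[a [c' [Aa ->]]] ->]]].
by exists (a + c * q), c'; split; [exists a, c | ring].
Qed.

Lemma adjoins_ideal A f k : is_ideal A -> is_ideal (adjoins A f k).
Proof. by move=> iA; elim: k => //= k; apply: adjoin_ideal. Qed.

Lemma adjoins_mem A f k i : is_ideal A -> (i < k)%N -> adjoins A f k (f i).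
Proof.
move=> iA; elim: k => //= k IH; rewrite ltnS leq_eqVlt => /orP[/eqP->|lt_ik].
  by rewrite -[X in adjoin _ _ X]mul1r; apply/adjoinM/adjoins_ideal.
by apply: adjoin_sub; apply: IH.
Qed.

Lemma adjoins_min A B f k : is_ideal B -> (forall x, A x -> B x) ->
  (forall i, (i < k)%N -> B (f i)) -> forall x, adjoins A f k x -> B x.
Proof.
move=> iB sAB; elim: k => //= k IH Bf x [a [c [Aa ->]]].
apply: in_idealD => //; first by apply: IH => // i lt_ik; apply: Bf; apply: ltnW.
by apply: in_idealM => //; apply: Bf.
Qed.

Lemma eq_adjoins A f f' k (x : R) :
  (forall i, (i < k)%N -> f i = f' i) -> adjoins A f k x -> adjoins A f' k x.
Proof.
elim: k x => //= k IH x ef; rewrite ef //; apply: adjoinS => z.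
by apply: IH => i lt_ik; apply: ef; apply: ltnW.
Qed.

Lemma ideal_gen_ideal (T : finType) (P : pred T) (F : T -> R) :
  is_ideal (ideal_gen P F).
Proof.
split.
- by exists (fun=> 0); rewrite big1 // => i _; rewrite mul0r.
- move=> x y [c ->] [c' ->]; exists (fun i => c i + c' i).
  by rewrite -big_split; apply: eq_bigr => i _; rewrite mulrDl.
- move=> a x [c ->]; exists (fun i => a * c i).
  by rewrite mulr_sumr; apply: eq_bigr => i _; rewrite mulrA.
Qed.

Lemma ideal_gen_mem (T : finType) (P : pred T) (F : T -> R) i :
  P i -> ideal_gen P F (F i).
Proof.
move=> Pi; exists (fun j => (j == i)%:R).
rewrite (bigD1 i) //= eqxx mul1r big1 ?addr0 // => j /andP[_ /negPf->].
by rewrite mul0r.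
Qed.

Lemma ideal_gen_min (T : finType) (P : pred T) (F : T -> R) A :
  is_ideal A -> (forall i, P i -> A (F i)) -> forall x, ideal_gen P F x -> A x.
Proof.
move=> iA AF x [c ->]; apply: ideal_sum => // i Pi.
by apply: in_idealM => //; apply: AF.
Qed.

(** The default [i0] of [insubd] is never reached: only indices below [r <= g] occur. *)
Lemma ideal_gen_adjoins g (i0 : 'I_g) (F : 'I_g -> R) r x : (r <= g)%N ->
  ideal_gen (fun j : 'I_g => (j < r)%N) F x
  <-> adjoins (fun y => y = 0) (fun m => F (insubd i0 m)) r x.
Proof.
move=> le_rg; split.
  apply: ideal_gen_min => [|i lt_ir].
    by apply: adjoins_ideal; apply: zero_ideal.
  have -> : F i = F (insubd i0 (val i)) by rewrite valKd.
  apply: (@adjoins_mem _ (fun m => F (insubd i0 m))) => //.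
  exact: zero_ideal.
apply: adjoins_min; first exact: ideal_gen_ideal.
  by move=> y ->; apply: in_ideal0; apply: ideal_gen_ideal.
move=> i lt_ir; apply: ideal_gen_mem.
by rewrite val_insubd (leq_trans lt_ir le_rg).
Qed.

Lemma ideal_gen_predT_adjoins g (i0 : 'I_g) (F : 'I_g -> R) x :
  ideal_gen predT F x
  <-> adjoins (fun y => y = 0) (fun m => F (insubd i0 m)) g x.
Proof.
rewrite -ideal_gen_adjoins //; split=> -[c ->]; exists c; apply: eq_bigl => i;
  by rewrite ltn_ord.
Qed.

End Adjoin.

(** * Setting a variable to zero, and graded Nakayama *)

Section KillVariable.
Variables (K : fieldType) (N : nat).
Local Notation S := {mpoly K[N]}.
Implicit Types (A : S -> Prop) (p q x h : S).

(** Constants and variables generate the ring; this reduces identities between ring morphisms to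
    generators. *)
Lemma mpoly_rect_ring (P : S -> Prop) :
  (forall c, P c%:MP) -> (forall i, P 'X_i) ->
  (forall p q, P p -> P q -> P (p + q)) ->
  (forall p q, P p -> P q -> P (p * q)) -> forall p, P p.
Proof.
move=> PC PX PD PM; elim/mpolyind => [|c m p _ _ Pp]; first exact: PC.
apply: PD => //; rewrite -mul_mpolyC; apply: (PM) => //.
rewrite mpolyXE_id; apply: (big_ind P); [by rewrite -mpolyC1 | exact: PM |].
move=> i _; elim: (m i) => [|k IH]; first by rewrite expr0 -mpolyC1.
by rewrite exprS; apply: PM.
Qed.

Definition kill (u : 'I_N) p : S := p \mPo [tuple if i == u then 0 else 'X_i | i < N].

HB.instance Definition _ u := GRing.RMorphism.copy (kill u)
  (comp_mpoly [tuple if i == u then 0 else 'X_i | i < N]).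

Lemma killX u i : kill u 'X_i = if i == u then 0 else 'X_i.
Proof. by rewrite /kill comp_mpolyXU -tnth_nth tnth_mktuple. Qed.

Lemma kill_div u p : exists h, p = kill u p + 'X_u * h.
Proof.
elim/mpoly_rect_ring: p => [c|i|p q [h ep] [k eq]|p q [h ep] [k eq]].
- by exists 0; rewrite /kill comp_mpolyC mulr0 addr0.
- rewrite killX; case: eqP => [->|_]; first by exists 1; ring.
  by exists 0; ring.
- by exists (h + k); rewrite rmorphD {1}ep {1}eq; ring.
- exists (kill u p * k + h * kill u q + 'X_u * h * k).
  by rewrite rmorphM {1}ep {1}eq; ring.
Qed.

Lemma mpolyX_neq0 i : 'X_i != 0 :> S.
Proof. by rewrite -msize_poly_eq0 msizeX. Qed.

(** Iterated, the condition says that all coefficients of [x] as a polynomial in [u] lie in [A]: the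
    ideal is extended from the polynomial ring in the other variables. *)
Definition free_of u A : Prop :=
  forall x, A x -> A (kill u x) /\ exists2 h, A h & x = kill u x + 'X_u * h.

Lemma free_of_zero u : free_of u (fun x => x = 0).
Proof.
by move=> x ->; rewrite rmorph0; split=> //; exists 0; rewrite ?mulr0 ?addr0.
Qed.

Lemma free_of_adjoin u A p :
  is_ideal A -> free_of u A -> kill u p = p -> free_of u (adjoin A p).
Proof.
move=> iA fA kp x [a [c [Aa ->]]].
have [Aka [h Ah ea]] := fA a Aa; have [c' ec] := kill_div u c.
have -> : kill u (a + c * p) = kill u a + kill u c * p.
  by rewrite rmorphD rmorphM /= kp.
split; first by exists (kill u a), (kill u c).
exists (h + c' * p); first by exists h, c'.
by rewrite {1}ea {1}ec; ring.
Qed.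

Lemma free_of_adjoins u A f k : is_ideal A -> free_of u A ->
  (forall i, (i < k)%N -> kill u (f i) = f i) -> free_of u (adjoins A f k).
Proof.
move=> iA fA; elim: k => //= k IH kf.
apply: free_of_adjoin; first exact: adjoins_ideal.
  by apply: IH => i lt_ik; apply: kf; apply: ltnW.
exact: kf.
Qed.

(** [kill u] annihilates ['X_u * h], so the quotient supplied by [free_of] is [h] itself. *)
Lemma free_of_cancel u A h : free_of u A -> A ('X_u * h) -> A h.
Proof.
move=> fA /fA[_ [k Ak]]; rewrite rmorphM /= killX eqxx mul0r add0r.
by move/(mulfI (mpolyX_neq0 u)) ->.
Qed.

Lemma pihomogM_homog d k p q :
  p \is d.-homog -> pihomog mdeg (k + d) (q * p) = pihomog mdeg k q * p.
Proof.
move=> hp; rewrite {1}(@pihomog_partitionE _ _ mdeg _ q (leqnn _)).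
rewrite mulr_suml linear_sum /=.
have hq i : pihomog mdeg i q * p \is (i + d).-homog.
  by apply: dhomogM => //; apply: pihomogP.
have [lt_k|le_k] := ltnP k (msize q).
  rewrite (bigD1 (Ordinal lt_k)) //= pihomog_dE // big1 ?addr0 // => i ne_ik.
  by rewrite (pihomog_ne0 _ (hq i)) // eqn_add2r.
rewrite big1 => [|i _].
  rewrite [X in X * p]pihomogE big_seq_cond big_pred0 ?mul0r // => m.
  apply/negP=> /andP[/msize_mdeg_lt lt_m /eqP em].
  by move: le_k; rewrite leqNgt -em lt_m.
rewrite (pihomog_ne0 _ (hq i)) // eqn_add2r neq_ltn.
by rewrite (leq_trans (ltn_ord i) le_k).
Qed.

Lemma homogeneous_zero : homogeneous_ideal (fun x : S => x = 0).
Proof. by move=> p -> d; rewrite linear0. Qed.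

Lemma homogeneous_adjoin d A p : is_ideal A ->
  homogeneous_ideal A -> p \is d.-homog -> homogeneous_ideal (adjoin A p).
Proof.
move=> iA hA hp x [a [c [Aa ->]]] k.
rewrite linearD /=; apply: in_idealD; first exact: adjoin_ideal.
  by apply: adjoin_sub; apply: hA.
have [le_dk|lt_kd] := leqP d k.
  by rewrite -(subnK le_dk) pihomogM_homog //; apply: adjoinM.
rewrite {1}(@pihomog_partitionE _ _ mdeg _ c (leqnn _)) mulr_suml linear_sum /=.
rewrite big1 => [|i _]; first by apply: in_ideal0; apply: adjoin_ideal.
apply: (@pihomog_ne0 _ _ _ (i + d)%N); first by lia.
by apply: dhomogM => //; apply: pihomogP.
Qed.

Lemma homogeneous_adjoins d A f k : is_ideal A -> homogeneous_ideal A ->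
  (forall i, f i \is d.-homog) -> homogeneous_ideal (adjoins A f k).
Proof.
move=> iA hA hf; elim: k => //= k IH.
by apply: (@homogeneous_adjoin d) => //; apply: adjoins_ideal.
Qed.

(* Graded Nakayama: iterating, an element of [Phi] lies in [A + u^k S] for
   every [k], and no homogeneous component of it survives in [u^k S]. *)
Lemma nakayama u A (Phi : S -> Prop) : is_ideal A -> homogeneous_ideal A ->
  (forall x, Phi x -> exists a h, [/\ A a, Phi h & x = a + 'X_u * h]) ->
  forall x, Phi x -> A x.
Proof.
move=> iA hA step x Px.
have iter k : exists a h, [/\ A a, Phi h & x = a + 'X_u ^+ k * h].
  elim: k => [|k [a [h [Aa Ph ->]]]].
    by exists 0, x; split=> //; [exact: in_ideal0 | ring].
  have [a' [h' [Aa' Ph' ->]]] := step h Ph.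
  exists (a + 'X_u ^+ k * a'), h'; split=> //; last by rewrite exprSr; ring.
  by apply: in_idealD => //; apply: in_idealM.
have [a [h [Aa _ ex]]] := iter (msize x).
rewrite (@pihomog_partitionE _ _ mdeg _ x (leqnn _)).
apply: ideal_sum => // -[i lt_i] _ /=.
suff -> : pihomog mdeg i x = pihomog mdeg i a by apply: hA.
rewrite [LHS](congr1 _ ex) linearD /= [X in _ + X](_ : _ = 0) ?addr0 //.
rewrite {1}(@pihomog_partitionE _ _ mdeg _ h (leqnn _)) mulr_sumr linear_sum /=.
(* Every component of ['X_u ^+ msize x * h] has degree at least [msize x], which exceeds [i]. *)
apply: big1 => j _; apply: (@pihomog_ne0 _ _ _ (msize x + j)%N).
  by lia.
apply: dhomogM; last exact: pihomogP.
by rewrite mpolyXn dhomogX /= mdegMn mdeg1 mul1n.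
Qed.

End KillVariable.

(** * Adding a generic linear form *)

Section ResidualStep.
Variables (K : fieldType) (N g d : nat).
Local Notation S := {mpoly K[N]}.
Variables (b : nat -> S) (I : S -> Prop).
Hypotheses (hom_b : forall j, b j \is d.-homog) (iI : is_ideal I).
Implicit Types (A : S -> Prop) (F : nat -> S -> Prop).

(** For an ideal [A] this is its saturation by [(b 0, ..., b (g-1))]: being killed by a power of
    each of finitely many generators amounts to being killed by a power of the ideal. *)
Definition torsion A : S -> Prop :=
  fun x => forall j, (j < g)%N -> exists k, A (b j ^+ k * x).

(** [F r] stands for the ideal of the rows added so far together with [b 0, ..., b (r-1)], and [I]
    for [(b 0, ..., b (g-1))]. The third clause is the claim aimed at; the fourth, that [b r] is a
    nonzerodivisor modulo the torsion, feeds the induction on rows. *)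
Definition residual_tower F : Prop :=
  [/\ forall r, is_ideal (F r) /\ homogeneous_ideal (F r),
      forall r x, (r < g)%N -> F r.+1 x <-> adjoin (F r) (b r) x,
      forall r x, (r <= g)%N -> I x -> torsion (F r) x -> F r x
    & forall r x, (r < g)%N -> torsion (F r) (x * b r) -> torsion (F r) x].

Lemma torsion_ideal A : is_ideal A -> is_ideal (torsion A).
Proof.
move=> iA; split=> [j _|x y Tx Ty j lt_j|a x Tx j lt_j].
- by exists 0%N; rewrite mulr0; apply: in_ideal0.
- have [k Ak] := Tx j lt_j; have [l Al] := Ty j lt_j.
  exists (k + l)%N; rewrite mulrDr; apply: in_idealD => //.
    by apply: in_idealXM Ak => //; apply: leq_addr.
  by apply: in_idealXM Al => //; apply: leq_addl.
- by have [k Ak] := Tx j lt_j; exists k; rewrite mulrCA; apply: in_idealM.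
Qed.

Lemma torsion_sub A B x : (forall y, A y -> B y) -> torsion A x -> torsion B x.
Proof. by move=> sAB Tx j /Tx[k Ak]; exists k; apply: sAB. Qed.

Lemma torsion_mem A x : A x -> torsion A x.
Proof. by move=> Ax j _; exists 0%N; rewrite expr0 mul1r. Qed.

Lemma homogeneous_torsion A :
  homogeneous_ideal A -> homogeneous_ideal (torsion A).
Proof.
move=> hA x Tx e j /Tx[k Ak]; exists k.
by rewrite mulrC -(@pihomogM_homog _ _ (d * k)) ?dhomogMn // mulrC; apply: hA.
Qed.

Lemma torsion_kill u A x : free_of u A ->
  (forall j, (j < g)%N -> kill u (b j) = b j) ->
  torsion A x -> torsion A (kill u x).
Proof.
move=> fA kb Tx j lt_j; have [k /fA[Ak _]] := Tx j lt_j; exists k.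
by rewrite rmorphM rmorphXn /= kb in Ak.
Qed.

Lemma torsion_cancel u A x : free_of u A -> torsion A ('X_u * x) -> torsion A x.
Proof.
move=> fA Tx j /Tx[k Ak]; exists k; apply: (free_of_cancel fA).
by rewrite mulrCA.
Qed.

Section Step.
Variables (F : nat -> S -> Prop) (u : nat -> 'I_N).
Hypothesis tF : residual_tower F.
Hypothesis u_inj : forall i j, (i < g)%N -> (j < g)%N -> u i = u j -> i = j.
Hypothesis kill_b : forall i j, (i < g)%N -> (j < g)%N -> kill (u i) (b j) = b j.
Hypothesis free_F :
  forall i r, (i < g)%N -> (r <= g)%N -> free_of (u i) (F r).
Hypothesis free_I : forall i, (i < g)%N -> free_of (u i) I.
Hypothesis I_b : forall i, (i < g)%N -> I (b i).

Let iF r : is_ideal (F r). Proof. by case: tF => h _ _ _; case: (h r). Qed.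
Let hF r : homogeneous_ideal (F r). Proof. by case: tF => h _ _ _; case: (h r). Qed.
Let FS r x : (r < g)%N -> F r.+1 x <-> adjoin (F r) (b r) x.
Proof. by case: tF => _ h _ _; apply: h. Qed.
Let FP r x : (r <= g)%N -> I x -> torsion (F r) x -> F r x.
Proof. by case: tF => _ _ h _; apply: h. Qed.
Let FQ r x : (r < g)%N -> torsion (F r) (x * b r) -> torsion (F r) x.
Proof. by case: tF => _ _ _; apply. Qed.

Lemma tower_b r j : (j < r)%N -> (r <= g)%N -> F r (b j).
Proof.
elim: r => // r IH; rewrite ltnS leq_eqVlt => /orP[/eqP->|lt_jr] lt_rg.
  by apply/FS => //; rewrite -[X in adjoin _ _ X]mul1r; apply: adjoinM.
by apply/FS => //; apply: adjoin_sub; apply: IH => //; apply: ltnW.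
Qed.

Definition partial_form c : S := \sum_(m < c) 'X_(u m) * b m.

Lemma kill_partial_form i c : (i < g)%N -> (c <= i)%N ->
  kill (u i) (partial_form c) = partial_form c.
Proof.
move=> lt_ig le_ci; rewrite rmorph_sum; apply: eq_bigr => m _ /=.
have lt_mi : (m < i)%N := leq_trans (ltn_ord m) le_ci.
have lt_mg := ltn_trans lt_mi lt_ig.
rewrite rmorphM /= killX kill_b //.
by case: eqP => // em; move: lt_mi; rewrite (@u_inj m i) ?ltnn.
Qed.

Lemma partial_formS c :
  partial_form c.+1 = partial_form c + 'X_(u c) * b c.
Proof. by rewrite /partial_form big_ord_recr. Qed.

Lemma partial_form_homog c : partial_form c \is d.+1.-homog.
Proof.
apply: rpred_sum => m _; rewrite -add1n; apply: dhomogM; last exact: hom_b.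
by rewrite dhomogX /= mdeg1.
Qed.

Lemma partial_form_small r c :
  (c <= r)%N -> (r <= g)%N -> F r (partial_form c).
Proof.
move=> le_cr le_rg; apply: ideal_sum => // m _; apply: in_idealM => //.
by apply: tower_b => //; apply: leq_trans le_cr.
Qed.

(** Induction on [c]. Modulo [F r] the form of length [r + 1] is [u_r b_r], and both factors are
    nonzerodivisors modulo the torsion. For longer forms, setting the last variable to [0] gives the
    shorter form, and Nakayama restores that variable. *)
Lemma partial_form_nzd r c x : (r < c)%N -> (c <= g)%N ->
  torsion (F r) (x * partial_form c) -> torsion (F r) x.
Proof.
move=> + le_cg; elim: c x le_cg => // c IH x lt_cg.
have le_cg := ltnW lt_cg.
rewrite ltnS leq_eqVlt => /orP[/eqP er|lt_rc].
  subst c; rewrite partial_formS mulrDr => Tx; apply: (FQ lt_cg).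
  apply: (@torsion_cancel (u r)); first exact: free_F.
  have iT := torsion_ideal (iF r).
  have Tp : torsion (F r) (x * partial_form r).
    by apply: torsion_mem; apply: in_idealM => //; apply: partial_form_small.
  by have := in_idealB iT Tx Tp; rewrite addrAC subrr add0r mulrCA.
have fF : free_of (u c) (F r) by apply: free_F => //; lia.
move: x; apply: (nakayama (u := u c)).
- exact: torsion_ideal.
- exact: homogeneous_torsion.
move=> x Tx; have [h ex] := kill_div (u c) x; exists (kill (u c) x), h.
have Tk : torsion (F r) (kill (u c) x).
  apply: IH => //.
  have := torsion_kill fF (fun j => @kill_b c j lt_cg) Tx.
  rewrite rmorphM partial_formS rmorphD rmorphM /= kill_partial_form //.
  by rewrite killX eqxx mul0r addr0.
split=> //; apply: (torsion_cancel fF).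
have iT := torsion_ideal (iF r).
have := in_idealB iT Tx (in_idealMr (partial_form c.+1) iT Tk).
by rewrite {1}ex mulrDl addrAC subrr add0r -mulrA.
Qed.

(** From [b_j^k x b_r = a + c l] it follows that [c l] lies in [F (r+1)]. As [l] is a nonzerodivisor
    modulo the torsion there, a power of [b_j] brings [c] into [F r + (b_r)], and [b_r] can then be
    cancelled modulo the torsion of [F r]. *)
Lemma torsion_adjoin_form r x : (r < g)%N ->
  torsion (adjoin (F r) (partial_form g)) (x * b r) ->
  torsion (adjoin (F r) (partial_form g)) x.
Proof.
move=> lt_rg Tx j lt_jg; have [k [a [c [Fa ec]]]] := Tx j lt_jg.
have Tc : torsion (F r.+1) c.
  have Fc : F r.+1 (c * partial_form g).
    apply/FS => //; exists (- a), (b j ^+ k * x).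
    by split; [exact: in_idealN | rewrite -mulrA ec; ring].
  (* When [r.+1 = g], all the [b i] lie in [F g], so every element is torsion. *)
  have [lt_r|ge_r] := ltnP r.+1 g.
    by apply: (partial_form_nzd lt_r (leqnn _)); apply: torsion_mem.
  move=> i lt_ig; exists 1%N; rewrite expr1; apply: in_idealMr => //.
  by apply: tower_b => //; lia.
have [l /FS [//|a' [c' [Fa' ec']]]] := Tc j lt_jg.
have Tz : torsion (F r) (b j ^+ (l + k) * x - c' * partial_form g).
  apply: FQ => //; apply: torsion_mem.
  rewrite mulrBl -mulrA exprD -!mulrA ec mulrDr.
  rewrite [X in _ + X - _]mulrA ec' mulrDl.
  have -> : b j ^+ l * a + (a' * partial_form g + c' * b r * partial_form g)
      - c' * (partial_form g * b r) = b j ^+ l * a + a' * partial_form g by ring.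
  by apply: in_idealD => //; [apply: in_idealM | apply: in_idealMr].
have [e Fe] := Tz j lt_jg; exists (e + (l + k))%N.
exists (b j ^+ e * (b j ^+ (l + k) * x - c' * partial_form g)), (b j ^+ e * c').
by split=> //; rewrite exprD; ring.
Qed.

(** Setting [u_c] to [0] in [b_j^k u_c x = a + y l] puts [kill y] times the shorter form in [F r].
    Hence [kill y] is torsion, the rest of [y] is divisible by [u_c], and [u_c] cancels modulo
    [F r]. *)
Lemma variable_nzd r c x : (r < c)%N -> (c < g)%N ->
  torsion (adjoin (F r) (partial_form c.+1)) ('X_(u c) * x) ->
  torsion (adjoin (F r) (partial_form c.+1)) x.
Proof.
move=> lt_rc lt_cg Tx j lt_jg; have [k [a [y [Fa ey]]]] := Tx j lt_jg.
have fF : free_of (u c) (F r) by apply: free_F => //; lia.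
have [Fka _] := fF a Fa; have [y' ey'] := kill_div (u c) y.
have : torsion (F r) (kill (u c) y).
  apply: (partial_form_nzd lt_rc (ltnW lt_cg)); apply: torsion_mem.
  have := congr1 (kill (u c)) ey.
  rewrite partial_formS !(rmorphM, rmorphD) /= killX eqxx mul0r mulr0.
  rewrite kill_partial_form // mul0r addr0 => /esym/eqP; rewrite addr_eq0.
  by move/eqP=> ek; rewrite -[X in F r X]opprK; apply: in_idealN => //; rewrite -ek.
move=> /(_ j lt_jg)[l Fl].
exists (l + k)%N.
exists (b j ^+ (l + k) * x - b j ^+ l * y' * partial_form c.+1), (b j ^+ l * y').
split; last by ring.
apply: (free_of_cancel fF).
have -> : 'X_(u c) * (b j ^+ (l + k) * x - b j ^+ l * y' * partial_form c.+1)
  = b j ^+ l * a + b j ^+ l * kill (u c) y * partial_form c.+1.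
  rewrite mulrBr exprD.
  have -> : 'X_(u c) * (b j ^+ l * b j ^+ k * x)
    = b j ^+ l * (b j ^+ k * ('X_(u c) * x)) by ring.
  by rewrite ey {1}ey'; ring.
by apply: in_idealD => //; [apply: in_idealM | apply: in_idealMr].
Qed.

(** The core of the induction: length [r + 1] follows from the claims for [F r] and [F (r+1)], and
    each further variable of the new row is added by Nakayama. *)
Lemma adjoin_partial_form r c x : (r < c)%N -> (c <= g)%N -> I x ->
  torsion (adjoin (F r) (partial_form c)) x -> adjoin (F r) (partial_form c) x.
Proof.
move=> + le_cg; elim: c x le_cg => // c IH x lt_cg.
have le_cg := ltnW lt_cg.
(* Setting [u_c] to [0] turns the form of length [c + 1] into the form of length [c]. *)
have kill_adjoin : (r <= c)%N -> forall y,
    torsion (adjoin (F r) (partial_form c.+1)) y ->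
    torsion (adjoin (F r) (partial_form c)) (kill (u c) y).
  move=> le_rc y Ty j lt_jg; have [k [a [z [Fa ez]]]] := Ty j lt_jg.
  have fF : free_of (u c) (F r) by apply: free_F => //; lia.
  have [Fka _] := fF a Fa.
  exists k, (kill (u c) a), (kill (u c) z); split=> //.
  have := congr1 (kill (u c)) ez.
  rewrite partial_formS !(rmorphM, rmorphD, rmorphXn) /= killX eqxx mul0r addr0.
  by rewrite kill_partial_form // kill_b.
rewrite ltnS leq_eqVlt => /orP[/eqP er|lt_rc].
  subst c => Ix Tx; have [h ex] := kill_div (u r) x.
  have fF : free_of (u r) (F r) by apply: free_F.
  have [Ik _] := free_I lt_cg Ix.
  (* The form of length [r] already lies in [F r], so [kill (u r) x] is torsion modulo [F r]
     itself. *)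
  have Fk : F r (kill (u r) x).
    apply: FP => //; apply: torsion_sub (kill_adjoin (leqnn r) x Tx) => y.
    case=> [a [c [Fa ->]]]; apply: in_idealD => //; apply: in_idealM => //.
    exact: partial_form_small.
  have Eh : 'X_(u r) * h = x - kill (u r) x by rewrite {1}ex; ring.
  have Ih : I h.
    by apply: (free_of_cancel (free_I lt_cg)); rewrite Eh; apply: in_idealB.
  (* The claim one level higher enters here: the form of length [r + 1] lies in [F r.+1], so [x],
     and with it [h], is torsion modulo [F r.+1]. *)
  have Fh : F r.+1 h.
    apply: FP => //; apply: (@torsion_cancel (u r)); first exact: free_F.
    rewrite Eh; apply: (in_idealB (A := torsion (F r.+1))); first exact: torsion_ideal.
      apply: torsion_sub Tx => y [a [c [Fa ->]]]; apply/FS => //.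
      exists (a + c * partial_form r), (c * 'X_(u r)).
      rewrite partial_formS; split; last by ring.
      by apply: in_idealD => //; apply: in_idealM => //; apply: partial_form_small.
    by apply: torsion_mem; apply/FS => //; apply: adjoin_sub.
  have [h1 _] := FS h lt_cg; have [a [c [Fa eh]]] := h1 Fh.
  (* Here [h = a + c b_r], and [u_r b_r] is the difference of the forms of lengths [r + 1] and
     [r]. *)
  exists (kill (u r) x + 'X_(u r) * a - c * partial_form r), c.
  split; last by rewrite {1}ex eh partial_formS; ring.
  apply: in_idealB => //; last by apply: in_idealM => //; apply: partial_form_small.
  by apply: in_idealD => //; apply: in_idealM.
move=> Ix Tx.
pose Phi y := I y /\ torsion (adjoin (F r) (partial_form c.+1)) y.
apply: (nakayama (u := u c) (Phi := Phi)) => //.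
- exact: adjoin_ideal.
- by apply: homogeneous_adjoin (partial_form_homog _).
move=> {x Ix Tx} x [Ix Tx].
have iE := adjoin_ideal (partial_form c.+1) (iF r).
have [Ik _] := free_I lt_cg Ix.
(* The shorter form is the longer one minus [u_c b_c]; the correction goes into the quotient
   [h - y * b c], which satisfies [Phi] again. *)
have [a [y [Fa ek]]] := IH _ le_cg lt_rc Ik (kill_adjoin (ltnW lt_rc) x Tx).
have [h ex] := kill_div (u c) x.
exists (a + y * partial_form c.+1), (h - y * b c).
have Fe : adjoin (F r) (partial_form c.+1) (a + y * partial_form c.+1).
  by exists a, y.
have ex' : x = a + y * partial_form c.+1 + 'X_(u c) * (h - y * b c).
  by rewrite ex ek partial_formS; ring.
split=> //; split.
  apply: (free_of_cancel (free_I lt_cg)).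
  have -> : 'X_(u c) * (h - y * b c) = x - kill (u c) x - y * 'X_(u c) * b c.
    by rewrite {1}ex; ring.
  by apply: in_idealB => //; [apply: in_idealB | apply: in_idealM => //; apply: I_b].
apply: variable_nzd => //.
have -> : 'X_(u c) * (h - y * b c) = x - (a + y * partial_form c.+1).
  by rewrite {1}ex'; ring.
by apply: in_idealB (torsion_mem Fe) => //; apply: torsion_ideal.
Qed.

Lemma residual_tower_step :
  residual_tower (fun r => adjoin (F r) (partial_form g)).
Proof.
split=> [r|r x lt_rg|r x le_rg Ix|r x]; last exact: torsion_adjoin_form.
- split; first exact: adjoin_ideal.
  exact: homogeneous_adjoin (partial_form_homog _).
- split=> [|/adjoinC]; last by apply: adjoinS => y /FS; apply.
  by move=> Fx; apply: adjoinC; apply: adjoinS Fx => y /FS; apply.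
move: le_rg; rewrite leq_eqVlt => /orP[/eqP->|lt_rg].
  (* At [r = g] every element is torsion modulo [F g], so the claim for [F g] puts all of [I] in
     [F g]. *)
  move=> _; apply: adjoin_sub; apply: FP => // j lt_jg; exists 1%N.
  by rewrite expr1; apply: in_idealMr => //; apply: tower_b.
exact: adjoin_partial_form.
Qed.

End Step.
End ResidualStep.

(** * Algebraic dependence and chains of primes *)

Section Dimension.
Variable K : fieldType.

Lemma eq_comp_mpoly k N (s t : k.-tuple {mpoly K[N]}) p :
  tnth s =1 tnth t -> p \mPo s = p \mPo t.
Proof. by move=> est; congr (_ \mPo _); apply: eq_from_tnth. Qed.

Lemma comp_mpolyA k l N (s : k.-tuple {mpoly K[l]}) (t : l.-tuple {mpoly K[N]}) p :
  (p \mPo s) \mPo t = p \mPo [tuple tnth s i \mPo t | i < k].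
Proof.
elim/mpoly_rect_ring: p => [c|i|p q ep eq|p q ep eq].
- by rewrite !comp_mpolyC.
- by rewrite !comp_mpolyXU -!tnth_nth tnth_mktuple.
- by rewrite !rmorphD /= ep eq.
- by rewrite !rmorphM /= ep eq.
Qed.

Lemma msize_comp_mpolyX k N e (t : k.-tuple {mpoly K[N]}) m :
  (forall i, (msize (tnth t i) <= e.+1)%N) ->
  (msize ('X_[m] \mPo t) <= (e * mdeg m).+1)%N.
Proof.
move=> le_t; rewrite comp_mpolyX mdegE big_distrr /=.
have msizeM1 (p q : {mpoly K[N]}) i j : (msize p <= i.+1)%N -> (msize q <= j.+1)%N ->
    (msize (p * q) <= (i + j).+1)%N.
  have [->|p0] := eqVneq p 0; first by rewrite mul0r msize0.
  have [->|q0] := eqVneq q 0; first by rewrite mulr0 msize0.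
  move=> le_p le_q; rewrite msizeM // -subn1 leq_subLR.
  by have := leq_add le_p le_q; rewrite addSn addnS.
apply: (big_rec2 (fun p i => (msize p <= i.+1)%N)); first by rewrite msize1.
move=> i c p _ le_p; apply: (msizeM1) => //.
elim: (m i) => [|l IH]; first by rewrite expr0 msize1.
by rewrite exprS mulnS; apply: msizeM1.
Qed.

(** By counting: the monomials in [k] variables with exponents below [M] outnumber the monomials
    that can occur in their images, so the images are linearly dependent. *)
Lemma comp_mpoly_dependent k N (t : k.-tuple {mpoly K[N]}) :
  (N < k)%N -> exists2 p, p != 0 & p \mPo t = 0.
Proof.
move=> lt_Nk.
(* [e] bounds the degrees of [t], so the images have degree at most [e * k * M < C * M = D]; and
   [M > C ^ N] gives [D ^ N < M ^ N.+1 <= M ^ k]. *)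
pose e := (\max_i msize (tnth t i))%N; pose C := (k * e).+1.
pose M := (C ^ N).+1; pose D := (C * M)%N.
pose T1 := {ffun 'I_k -> 'I_M}; pose T2 := {ffun 'I_N -> 'I_D}.
pose m1 (a : T1) := [multinom (a i : nat) | i < k].
pose m2 (a : T2) := [multinom (a i : nat) | i < N].
have lt_card : (#|T2| < #|T1|)%N.
  rewrite !card_ffun !card_ord expnMn.
  apply: (@leq_trans (M ^ N.+1)); last by rewrite leq_pexp2l.
  by rewrite expnS ltn_mul2r expn_gt0 ltnSn.
pose B := \matrix_(i < #|T1|, j < #|T2|)
  ('X_[m1 (enum_val i)] \mPo t)@_(m2 (enum_val j)).
have : kermx B != 0.
  rewrite -mxrank_eq0 mxrank_ker subn_eq0 -ltnNge.
  by apply: leq_ltn_trans lt_card; apply: rank_leq_col.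
case/rowV0Pn=> v /sub_kermxP vB v0.
pose p := \sum_i v 0 i *: 'X_[K, m1 (enum_val i)].
have m1_inj : injective m1.
  move=> a a' /mnmP eaa'; apply/ffunP => i; apply: val_inj.
  by have := eaa' i; rewrite !mnmE.
exists p.
  apply: contra_neq v0 => p0; apply/rowP => i; rewrite mxE.
  have := congr1 (mcoeff (m1 (enum_val i))) p0.
  rewrite mcoeff0 raddf_sum (bigD1 i) //= big1 ?addr0 => [|j ne_ji].
    by rewrite mcoeffZ mcoeffX eqxx mulr1.
  rewrite mcoeffZ mcoeffX (inj_eq m1_inj) (inj_eq enum_val_inj) (negPf ne_ji).
  by rewrite mulr0.
apply/mpolyP => m; rewrite mcoeff0.
have -> : p \mPo t = \sum_i v 0 i *: ('X_[m1 (enum_val i)] \mPo t).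
  by rewrite linear_sum; apply: eq_bigr => i _; rewrite linearZ.
rewrite raddf_sum /=.
(* Every monomial of degree below [D] indexes a column of [B]; the others do not occur in the
   images. *)
have [lt_mD|ge_mD] := ltnP (mdeg m) D.
  have lt_m i : (m i < D)%N.
    by apply: leq_ltn_trans lt_mD; rewrite mdegE (bigD1 i) //= leq_addr.
  have em : m = m2 [ffun i => Ordinal (lt_m i)].
    by apply/mnmP => i; rewrite mnmE ffunE.
  have := congr1 (fun w : 'rV_ _ => w 0 (enum_rank [ffun i => Ordinal (lt_m i)])) vB.
  rewrite !mxE => vB0; rewrite -[RHS]vB0; apply: eq_bigr => i _.
  by rewrite mcoeffZ mxE enum_rankK -em.
rewrite big1 // => i _; rewrite mcoeffZ.
rewrite (memN_msupp_eq0 (p := _ \mPo _)) ?mulr0 //.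
apply: msize_mdeg_ge; apply: leq_trans ge_mD.
apply: leq_trans (@msize_comp_mpolyX _ _ e _ _ _) _.
  by move=> j; apply: leqW; apply: (leq_bigmax j).
have : (mdeg (m1 (enum_val i)) <= k * M)%N.
  rewrite mdegE -[k in (_ <= k * _)%N]card_ord -sum_nat_const.
  by apply: leq_sum => j _; rewrite mnmE ltnW.
rewrite /D /C => le_m; rewrite mulSn addnC -addn1 leq_add //.
by apply: leq_trans (leq_mul (leqnn e) le_m) _; rewrite mulnA (mulnC e).
Qed.

Variable N : nat.
Local Notation S := {mpoly K[N]}.
Implicit Types (P Q : S -> Prop).

Definition independent_mod P k (t : k.-tuple S) : Prop :=
  forall p, P (p \mPo t) -> p = 0.

Lemma independent_mod_leq P k (t : k.-tuple S) :
  is_ideal P -> independent_mod P t -> (k <= N)%N.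
Proof.
move=> iP ind_t; rewrite leqNgt; apply/negP => /(comp_mpoly_dependent t)[p].
by move=> /eqP p0 pt; apply: p0; apply: ind_t; rewrite pt; apply: in_ideal0.
Qed.

(* If [p(t, w)] is in [P] then [p(t, 0)] is in [Q], so [p = 'X_k * h] by
   independence, and [h(t, w)] is in [P] since [w] is not. *)
Lemma independent_mod_extend P Q k (t : k.-tuple S) w :
  is_prime P -> is_prime Q -> ideal_sub P Q -> Q w -> ~ P w ->
  independent_mod Q t -> exists t' : k.+1.-tuple S, independent_mod P t'.
Proof.
move=> [iP _ prP] [iQ _ _] sPQ Qw nPw ind_t.
pose F i := if unlift ord_max i is Some j then tnth t j else w.
exists [tuple F i | i < k.+1].
(* Nakayama over the zero ideal acts as a descent: if every relation is ['X_ord_max] times another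
   relation, all relations vanish. *)
apply: (nakayama (u := ord_max)); [exact: zero_ideal | exact: homogeneous_zero |].
move=> p Pp; have [h ep] := kill_div ord_max p.
pose p0 := p \mPo
  [tuple if unlift ord_max i is Some j then 'X_j else 0 : {mpoly K[k]} | i < k.+1].
have Xw : 'X_ord_max \mPo [tuple F i | i < k.+1] = w.
  by rewrite comp_mpolyXU -tnth_nth tnth_mktuple /F unlift_none.
have e0 : p0 \mPo t = kill ord_max p \mPo [tuple F i | i < k.+1].
  rewrite !comp_mpolyA; apply: eq_comp_mpoly => i; rewrite !tnth_mktuple.
  rewrite (fun_if (comp_mpoly _)) comp_mpoly0 comp_mpolyXU -tnth_nth tnth_mktuple /F.
  case: unliftP => [j ->|->]; last by rewrite eqxx comp_mpoly0.
  by rewrite eq_sym (negPf (neq_lift _ _)) comp_mpolyXU -tnth_nth.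
have p00 : p0 = 0.
  apply: ind_t; rewrite e0.
  have -> : kill ord_max p \mPo [tuple F i | i < k.+1] =
    p \mPo [tuple F i | i < k.+1] - (h \mPo [tuple F i | i < k.+1]) * w.
    by rewrite {2}ep rmorphD rmorphM /= Xw; ring.
  by apply: in_idealB => //; [apply: sPQ | apply: in_idealM].
have k0 : kill ord_max p = 0.
  have -> : kill ord_max p = p0 \mPo [tuple 'X_(lift ord_max j) | j < k].
    rewrite comp_mpolyA; apply: eq_comp_mpoly => i; rewrite !tnth_mktuple.
    case: unliftP => [j ->|->]; last by rewrite eqxx comp_mpoly0.
    by rewrite eq_sym (negPf (neq_lift _ _)) comp_mpolyXU -tnth_nth tnth_mktuple.
  by rewrite p00 comp_mpoly0.
exists 0, h; rewrite add0r; split=> //; last by rewrite {1}ep k0 add0r.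
have [] // := prP (h \mPo [tuple F i | i < k.+1]) w.
by move: Pp; rewrite {1}ep k0 add0r rmorphM /= Xw mulrC.
Qed.

(** Each strict step down the chain yields one more independent element; at the bottom there are
    [k + h] of them, hence at most [N]. *)
Lemma prime_chain_leq P k (t : k.-tuple S) h :
  independent_mod P t -> prime_chain P h -> (k + h <= N)%N.
Proof.
move=> ind_t [Q [prQ ltQ QP]].
have ext i : (i <= h)%N ->
    exists t' : (k + i).-tuple S, independent_mod (Q (h - i)%N) t'.
  elim: i => [_|i IH lt_ih].
    by rewrite addn0 subn0; exists t => p /QP; apply: ind_t.
  have [t' ind_t'] := IH (ltnW lt_ih); rewrite addnS.
  have lt_h : (h - i.+1 < h)%N by lia.
  have [] := ltQ _ lt_h; rewrite subnSK // => sQ nsQ.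
  have [w nimp] := not_all_ex_not _ _ nsQ; have [Qw nQw] := imply_to_and _ _ nimp.
  have prQ1 := prQ _ (ltnW lt_h).
  have prQ2 := prQ _ (leq_subr i h).
  exact: (independent_mod_extend prQ1 prQ2 sQ Qw nQw ind_t').
have [t' ind_t'] := ext h (leqnn h).
rewrite subnn in ind_t'; apply: (independent_mod_leq _ ind_t').
by case: (prQ 0%N (leq0n _)).
Qed.

End Dimension.

(** * Ideals of generic linear forms *)

Lemma adjoins_map (R R' : comNzRingType) (phi : {rmorphism R -> R'}) f k x :
  adjoins (fun z => z = 0) f k x ->
  adjoins (fun z => z = 0) (fun i => phi (f i)) k (phi x).
Proof.
elim: k x => [x ->|k IH x [a [c [/IH Aa ->]]]]; first by rewrite rmorph0.
by exists (phi a), (phi c); rewrite rmorphD rmorphM.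
Qed.

Section GenericForms.
Variables (K : fieldType) (n N s g : nat).
Local Notation S := {mpoly K[N]}.
Variables (x : 'I_n -> 'I_N) (y : nat -> nat -> 'I_N) (a : nat -> {mpoly K[n]}).
Hypothesis g_gt0 : (0 < g)%N.
Hypothesis x_inj : injective x.
Hypothesis x_neq_y : forall i j m, x i != y j m.
Hypothesis y_inj : forall i m i' m', (i < s)%N -> (m < g)%N -> (i' < s)%N ->
  (m' < g)%N -> y i m = y i' m' -> i = i' /\ m = m'.

Definition inject_x (p : {mpoly K[n]}) : S := p \mPo [tuple 'X_(x i) | i < n].

HB.instance Definition _ := GRing.RMorphism.copy inject_x
  (comp_mpoly [tuple 'X_(x i) | i < n]).

Definition project_tuple : N.-tuple {mpoly K[n]} :=
  [tuple if [pick i | x i == v] is Some i then 'X_i else 0 | v < N].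

Definition project_x (p : S) : {mpoly K[n]} := p \mPo project_tuple.

HB.instance Definition _ :=
  GRing.RMorphism.copy project_x (comp_mpoly project_tuple).

Lemma pick_x i : [pick i' | x i' == x i] = Some i.
Proof. by case: pickP => [j /eqP/x_inj->//|/(_ i)]; rewrite eqxx. Qed.

Lemma inject_xK p : project_x (inject_x p) = p.
Proof.
rewrite /project_x /project_tuple /inject_x comp_mpolyA -[RHS]comp_mpoly_id.
apply: eq_comp_mpoly => i; rewrite !tnth_mktuple comp_mpolyXU -tnth_nth.
by rewrite tnth_mktuple pick_x.
Qed.

Lemma inject_x_comp (t : N.-tuple S) p :
  (forall i, tnth t (x i) = 'X_(x i)) -> inject_x p \mPo t = inject_x p.
Proof.
move=> tx; rewrite /inject_x comp_mpolyA; apply: eq_comp_mpoly => i.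
by rewrite !tnth_mktuple comp_mpolyXU -tnth_nth.
Qed.

Local Notation b := (fun m => inject_x (a m)).
Local Notation zero := (fun z : S => z = 0).
Local Notation ell := (fun i => partial_form b (y i) g).

Lemma kill_inject_x i m p : kill (y i m) (inject_x p) = inject_x p.
Proof.
by apply: inject_x_comp => j; rewrite tnth_mktuple (negPf (x_neq_y _ _ _)).
Qed.

(** * Regularity in the larger polynomial ring, and the colon by the forms *)

Section Regularity.
Variable d : nat.
Hypothesis hom_a : forall m, a m \is d.-homog.
Hypothesis reg_a : forall r p, (r < g)%N ->
  adjoins (fun z => z = 0) a r (p * a r) -> adjoins (fun z => z = 0) a r p.

Lemma inject_x_homog m : b m \is d.-homog.
Proof.
rewrite /inject_x comp_mpolyEX big_seq; apply: rpred_sum => mu mu_in.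
apply: rpredZ; have {1}<- : mdeg mu = d by move/dhomogP: (hom_a m); apply.
rewrite comp_mpolyX mdegE; elim/big_rec2: _ => [|i e p _ hp].
  exact: dhomog1.
apply: dhomogM => //; rewrite tnth_mktuple -[X in X.-homog]mul1n.
by apply: dhomogMn; rewrite dhomogX /= mdeg1.
Qed.

Let iB r : is_ideal (adjoins zero b r) := adjoins_ideal b r (@zero_ideal _).

Let hB r : homogeneous_ideal (adjoins zero b r).
Proof.
apply: (homogeneous_adjoins (d := d)); first exact: zero_ideal.
  exact: homogeneous_zero.
exact: inject_x_homog.
Qed.

Let fB u r : (forall i, x i != u) -> free_of u (adjoins zero b r).
Proof.
move=> xu; apply: free_of_adjoins; [exact: zero_ideal | exact: free_of_zero |].
by move=> m _; apply: inject_x_comp => i; rewrite tnth_mktuple (negPf (xu i)).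
Qed.

Definition kill_seq (W : seq 'I_N) (p : S) : S :=
  p \mPo [tuple if v \in W then 0 else 'X_v | v < N].

HB.instance Definition _ W := GRing.RMorphism.copy (kill_seq W)
  (comp_mpoly [tuple if v \in W then 0 else 'X_v | v < N]).

Lemma kill_seq_kill u W p : kill_seq W (kill u p) = kill_seq (u :: W) p.
Proof.
rewrite /kill_seq /kill comp_mpolyA; apply: eq_comp_mpoly => v.
rewrite !tnth_mktuple inE; case: eqP => [_|_] /=; first by rewrite comp_mpoly0.
by rewrite comp_mpolyXU -tnth_nth tnth_mktuple.
Qed.

(** With all variables outside [x] set to [0] this is [reg_a]; Nakayama brings those variables back
    one at a time. *)
Lemma inject_x_regular r p : (r < g)%N ->
  adjoins zero b r (p * b r) -> adjoins zero b r p.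
Proof.
move=> lt_rg.
(* Induction on the list of killed variables: each variable leaving the list is restored by
   Nakayama. *)
have allP W : (forall v, v \in W -> forall i, x i != v) ->
    (forall q, adjoins zero b r (q * b r) -> adjoins zero b r (kill_seq W q)) ->
    forall q, adjoins zero b r (q * b r) -> adjoins zero b r q.
  elim: W => [_ H q /H|u W IH xW H].
    suff -> : kill_seq [::] q = q by [].
    rewrite -[RHS]comp_mpoly_id; apply: eq_comp_mpoly => v.
    by rewrite !tnth_mktuple.
  apply: IH => [v vW|]; first by apply: xW; rewrite inE vW orbT.
  have [uW|uW] := boolP (u \in W).
    move=> q /H; congr (adjoins _ _ _ _); apply: eq_comp_mpoly => v.
    by rewrite !tnth_mktuple inE; case: eqP => // ->; rewrite uW.
  have xu := xW u (mem_head _ _).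
  pose Phi q := exists2 q', adjoins zero b r (q' * b r) & q = kill_seq W q'.
  suff PhiB q : Phi q -> adjoins zero b r q by move=> q Bq; apply: PhiB; exists q.
  move: q; apply: (nakayama (u := u)) => // _ [q Bq ->].
  have [h eq] := kill_div u q.
  have [Bk _] := fB xu Bq.
  rewrite rmorphM /= [kill u (inject_x _)]inject_x_comp in Bk; last first.
    by move=> i; rewrite tnth_mktuple (negPf (xu i)).
  exists (kill_seq W (kill u q)), (kill_seq W h); split.
  - by rewrite kill_seq_kill; apply: H.
  - exists h => //; apply: (free_of_cancel (fB xu)).
    have -> : 'X_u * (h * b r) = q * b r - kill u q * b r by rewrite {1}eq; ring.
    exact: in_idealB.
  - rewrite {1}eq rmorphD rmorphM /=; congr (_ + _ * _).
    by rewrite /kill_seq comp_mpolyXU -tnth_nth tnth_mktuple (negPf uW).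
apply: (allP [seq v <- enum 'I_N | [forall i, x i != v]]).
  by move=> v; rewrite mem_filter => /andP[/forallP].
move=> q /(adjoins_map project_x).
rewrite rmorphM /= inject_xK => Aq.
(* Killing every variable outside [x] is the same as projecting to [R] and injecting back. *)
have -> : kill_seq [seq v <- enum 'I_N | [forall i, x i != v]] q
  = inject_x (project_x q).
  rewrite /kill_seq /inject_x /project_x /project_tuple comp_mpolyA.
  apply: eq_comp_mpoly => v.
  rewrite !tnth_mktuple mem_filter mem_enum andbT; case: pickP => [i /eqP <-|nx].
    rewrite comp_mpolyXU -tnth_nth tnth_mktuple; case: forallP => // /(_ i).
    by rewrite eqxx.
  by case: forallP => [_|[] i]; rewrite ?comp_mpoly0 ?nx.
apply: adjoins_map; apply: reg_a => //.
have eA k z : adjoins (fun z => z = 0) (fun m => project_x (b m)) k z ->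
    adjoins (fun z => z = 0) a k z.
  elim: k z => //= k IH z [c [e [/IH Ac ->]]]; exists c, e.
  by rewrite inject_xK.
exact: eA.
Qed.

Let bg := adjoins zero b g.

(** Induction on the rows. With no row the claims come from the regularity of [b];
    [residual_tower_step] applies to a new row because its variables occur in no earlier one. *)
Lemma residual_tower_forms k : (k <= s)%N ->
  residual_tower g b bg (fun r => adjoins (adjoins zero b r) ell k).
Proof.
elim: k => [_|k IH lt_ks] /=.
  split=> [r|r p _|r p|r p lt_rg Tp j lt_jg]; [by split | by [] | |].
    rewrite leq_eqVlt => /orP[/eqP->//|lt_rg] _ Tp.
    have [k] := Tp r lt_rg; elim: k => [|k IH]; first by rewrite expr0 mul1r.
    by rewrite exprS -mulrA mulrC => /(inject_x_regular lt_rg).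
  have [k Bk] := Tp j lt_jg; exists k; apply: inject_x_regular => //.
  by rewrite -mulrA.
apply: (residual_tower_step (d := d)) => //.
- exact: inject_x_homog.
- exact: iB.
- exact: IH (ltnW lt_ks).
- by move=> i j lt_ig lt_jg /y_inj[].
- by move=> i j _ _; apply: kill_inject_x.
- move=> i r lt_ig _; apply: free_of_adjoins => //.
    exact: fB (fun j => x_neq_y j k i).
  move=> j lt_jk; rewrite rmorph_sum; apply: eq_bigr => m _ /=.
  rewrite rmorphM /= kill_inject_x killX; case: eqP => // /y_inj[] //.
    exact: ltn_trans lt_ks.
  by move=> ej; rewrite ej ltnn in lt_jk.
- by move=> i _; apply: fB => j; apply: x_neq_y.
- by move=> i lt_ig; apply: (adjoins_mem b) => //; apply: zero_ideal.
Qed.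

(** The ideal [Q_k], saturated by [b 0] alone so as to be the kernel of [solve k] for [k <= s]. *)
Definition saturation k (p : S) : Prop :=
  exists e, adjoins zero ell k (b 0%N ^+ e * p).

(** [b 0] is a nonzerodivisor modulo the torsion of the row ideal, so [b 0 ^+ e] can be stripped and
    [p] is torsion. Then [p * b j] is torsion and lies in [(b)], hence in the row ideal. *)
Lemma saturation_colon p j : (j < g)%N ->
  saturation s p -> adjoins zero ell s (p * b j).
Proof.
move=> lt_jg [e /torsion_mem Te].
have [/(_ 0%N)[iL _] _ towP towQ] := residual_tower_forms (leqnn s).
apply: (towP 0%N) => //.
  apply: in_idealM; first exact: iB.
  by apply: (adjoins_mem b) => //; apply: zero_ideal.
apply: (in_idealMr (A := torsion g b _)); first exact: torsion_ideal.
have {}Te := Te g b; elim: e Te => [|e IH]; first by rewrite mul1r.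
by rewrite exprS -mulrA mulrC => /(towQ 0%N _ g_gt0)/IH.
Qed.

End Regularity.

(** * Primality and height of the saturation *)

Section Saturation.
Hypothesis a0_neq0 : a 0%N != 0.

Lemma b0_neq0 : inject_x (a 0%N) != 0.
Proof.
by apply: contra_neq a0_neq0 => b0; rewrite -[a 0%N]inject_xK b0 rmorph0.
Qed.

Local Notation F := {fraction S}.
Local Notation "p %:F" := (@FracField.tofrac S p).

(* The first [k] linear equations [ell i = 0], solved for [Y_i0]. *)
Definition solution k (v : 'I_N) : F :=
  if [pick i : 'I_k | v == y i 0%N] is Some i
  then - (\sum_(1 <= m < g) ('X_(y i m) * b m)%:F) / (b 0%N)%:F
  else ('X_v)%:F.

Definition solve k (p : S) : F :=
  mmap (@FracField.tofrac S \o @mpolyC N K) (solution k) p.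

HB.instance Definition _ k := GRing.RMorphism.copy (solve k)
  (mmap (@FracField.tofrac S \o @mpolyC N K) (solution k)).

Lemma solveX k v : solve k 'X_v = solution k v.
Proof. by rewrite /solve mmapX mmap1U. Qed.

Lemma solve_inject_x k p : solve k (inject_x p) = (inject_x p)%:F.
Proof.
elim/mpoly_rect_ring: p => [c|i|p q ep eq|p q ep eq].
- by rewrite /inject_x comp_mpolyC /solve mmapC.
- rewrite /inject_x comp_mpolyXU -tnth_nth tnth_mktuple solveX /solution.
  by case: pickP => // j; rewrite (negPf (x_neq_y _ _ _)).
- by rewrite !rmorphD /= ep eq.
- by rewrite !rmorphM /= ep eq.
Qed.

Lemma partial_form_split i :
  ell i = 'X_(y i 0%N) * b 0%N + \sum_(1 <= m < g) 'X_(y i m) * b m.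
Proof.
by rewrite /partial_form -(big_mkord predT (fun m => 'X_(y i m) * b m)) big_ltn.
Qed.

Lemma solve_tail k i : (k <= s)%N -> (i < s)%N ->
  solve k (\sum_(1 <= m < g) 'X_(y i m) * b m)
  = \sum_(1 <= m < g) ('X_(y i m) * b m)%:F.
Proof.
move=> le_ks lt_is; rewrite rmorph_sum; apply: eq_big_nat => m /andP[m_gt0 lt_mg].
rewrite !rmorphM /= solve_inject_x solveX /solution.
case: pickP => // j /eqP ej.
have [_ em] := y_inj lt_is lt_mg (leq_trans (ltn_ord j) le_ks) g_gt0 ej.
by rewrite em in m_gt0.
Qed.

Lemma solve_partial_form_lt k i : (k <= s)%N -> (i < k)%N -> solve k (ell i) = 0.
Proof.
move=> le_ks lt_ik; have lt_is := leq_trans lt_ik le_ks.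
rewrite partial_form_split rmorphD rmorphM /= solve_tail // solve_inject_x solveX.
rewrite /solution; case: pickP => [j /eqP ej|/(_ (Ordinal lt_ik))].
  have [<- _] := y_inj lt_is g_gt0 (leq_trans (ltn_ord j) le_ks) g_gt0 ej.
  by rewrite divfK ?addNr // tofrac_eq0 b0_neq0.
by rewrite eqxx.
Qed.

Lemma solve_partial_form_ge k i :
  (k <= i)%N -> (i < s)%N -> solve k (ell i) = (ell i)%:F.
Proof.
move=> le_ki lt_is; have le_ks := ltnW (leq_ltn_trans le_ki lt_is).
rewrite partial_form_split rmorphD rmorphM /= solve_tail // solve_inject_x solveX.
rewrite [in RHS]rmorphD [in RHS]rmorphM [X in _ = _ + X]rmorph_sum /solution /=.
case: pickP => // j /eqP ej.
have [ei _] := y_inj lt_is g_gt0 (leq_trans (ltn_ord j) le_ks) g_gt0 ej.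
by move: (ltn_ord j); rewrite -ei ltnNge le_ki.
Qed.

Lemma partial_form_neq0 i : (i < s)%N -> ell i != 0.
Proof.
move=> lt_is; apply: contra_neq b0_neq0 => e0.
(* Specializing [y i 0] to [1] and all other [Y] variables to [0] sends [ell i] to [b 0]. *)
pose t : N.-tuple S := [tuple if v == y i 0%N then 1 else
                 if [exists j, x j == v] then 'X_v else 0 | v < N].
have tb m : b m \mPo t = b m.
  apply: inject_x_comp => j; rewrite tnth_mktuple (negPf (x_neq_y _ _ _)).
  by case: existsP => // -[]; exists j.
have := congr1 (comp_mpoly t) e0.
rewrite comp_mpoly0 partial_form_split rmorphD rmorphM [X in _ + X]rmorph_sum /= tb.
rewrite comp_mpolyXU -tnth_nth tnth_mktuple eqxx mul1r big_nat big1 ?addr0 //.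
move=> m /andP[m_gt0 lt_mg]; rewrite rmorphM /= comp_mpolyXU -tnth_nth tnth_mktuple.
case: eqP => [em|_].
  by have [_ em0] := y_inj lt_is lt_mg lt_is g_gt0 em; rewrite em0 in m_gt0.
by case: existsP => [[j]|_]; rewrite ?mul0r // (negPf (x_neq_y _ _ _)).
Qed.

(** Denominators are cleared: [q] is a numerator of [solve k p] and agrees with [b 0 ^+ e * p]
    modulo the forms. The property is stable under sums and products, so constants and variables
    suffice. *)
Lemma solve_approx k p : exists e q,
  adjoins zero ell k (b 0%N ^+ e * p - q)
  /\ q%:F = (b 0%N)%:F ^+ e * solve k p.
Proof.
have iL := adjoins_ideal ell k (@zero_ideal S).
have b0F : (b 0%N)%:F != 0 :> F by rewrite tofrac_eq0 b0_neq0.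
elim/mpoly_rect_ring: p => [c|v|p p' [e [q [A eq]]] [e' [q' [A' eq']]]
                           |p p' [e [q [A eq]]] [e' [q' [A' eq']]]].
- exists 0%N, c%:MP; rewrite !expr0 !mul1r subrr; split; first exact: in_ideal0.
  by rewrite /solve mmapC.
- rewrite solveX /solution; case: pickP => [i /eqP->|_]; last first.
    by exists 0%N, 'X_v; rewrite !expr0 !mul1r subrr; split=> //; exact: in_ideal0.
  exists 1%N, (- \sum_(1 <= m < g) 'X_(y i m) * b m); split.
    rewrite expr1 opprK mulrC -partial_form_split.
    by apply: (adjoins_mem ell) => //; apply: zero_ideal.
  by rewrite expr1 mulrC divfK // rmorphN rmorph_sum.
- exists (e + e')%N, (b 0%N ^+ e' * q + b 0%N ^+ e * q'); split; last first.
    by rewrite rmorphD !rmorphM !rmorphXn /= eq eq' rmorphD exprD /=; ring.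
  have -> : b 0%N ^+ (e + e') * (p + p') - (b 0%N ^+ e' * q + b 0%N ^+ e * q')
    = b 0%N ^+ e' * (b 0%N ^+ e * p - q) + b 0%N ^+ e * (b 0%N ^+ e' * p' - q').
    by rewrite exprD; ring.
  by apply: in_idealD => //; apply: in_idealM.
- exists (e + e')%N, (q * q'); split; last first.
    by rewrite rmorphM /= eq eq' rmorphM exprD /=; ring.
  have -> : b 0%N ^+ (e + e') * (p * p') - q * q'
    = (b 0%N ^+ e' * p') * (b 0%N ^+ e * p - q) + q * (b 0%N ^+ e' * p' - q').
    by rewrite exprD; ring.
  by apply: in_idealD => //; apply: in_idealM.
Qed.

(** Identifies the saturation with the kernel of a morphism into a field, whence its primality. *)
Lemma saturationP k p : (k <= s)%N -> saturation k p <-> solve k p = 0.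
Proof.
move=> le_ks; have iL := adjoins_ideal ell k (@zero_ideal S); split=> [[e Ap]|p0].
  have b0F : (b 0%N)%:F ^+ e != 0 :> F by rewrite expf_neq0 // tofrac_eq0 b0_neq0.
  apply: (mulfI b0F); rewrite mulr0.
  have -> : (b 0%N)%:F ^+ e * solve k p = solve k (b 0%N ^+ e * p).
    by rewrite rmorphM rmorphXn /= solve_inject_x.
  move: Ap; pose A z := solve k z = 0.
  apply: (adjoins_min (B := A)) => [|z ->|i lt_ik].
  - rewrite /A; split=> [|z z' z0 z0'|z z' z0]; first exact: rmorph0.
      by rewrite rmorphD /= z0 z0' addr0.
    by rewrite rmorphM /= z0 mulr0.
  - exact: rmorph0.
  - exact: solve_partial_form_lt.
have [e [q [Aq eq]]] := solve_approx k p; exists e.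
move: eq; rewrite p0 mulr0 => /eqP; rewrite tofrac_eq0 => /eqP q0.
by move: Aq; rewrite q0 subr0.
Qed.

Lemma saturation_prime k : (k <= s)%N -> is_prime (saturation k).
Proof.
move=> le_ks; split.
- split=> [|p q /saturationP p0 /saturationP q0|p q /saturationP q0].
  + by apply/saturationP; rewrite // rmorph0.
  + by apply/saturationP; rewrite // rmorphD /= p0 // q0 // addr0.
  + by apply/saturationP; rewrite // rmorphM /= q0 // mulr0.
- by move/saturationP => /(_ le_ks)/eqP; rewrite rmorph1 oner_eq0.
move=> p q /saturationP => /(_ le_ks)/eqP; rewrite rmorphM /= mulf_eq0.
by case/orP => /eqP e0; [left | right]; apply/saturationP.
Qed.

(** [ell i] separates [saturation i] from [saturation i.+1]: [solve i] leaves it unchanged, hence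
    nonzero. *)
Lemma saturation_chain k : (k <= s)%N -> prime_chain (saturation k) k.
Proof.
move=> le_ks; exists saturation; split=> // [i le_ik|i lt_ik].
  by apply: saturation_prime; apply: leq_trans le_ks.
have lt_is := leq_trans lt_ik le_ks; split=> [p [e Ap]|sub].
  by exists e => /=; apply: adjoin_sub.
have /saturationP : saturation i (ell i).
  apply: sub; exists 0%N; rewrite expr0 mul1r.
  by apply: (adjoins_mem ell) => //; apply: zero_ideal.
move/(_ (ltnW lt_is))/eqP; rewrite solve_partial_form_ge // tofrac_eq0.
by rewrite (negPf (partial_form_neq0 lt_is)).
Qed.

(** [solve s] fixes every variable except the [s] variables [y i 0], so a relation among the others
    modulo the saturation is a relation between indeterminates. *)
Lemma saturation_independent :
  exists t : (N - s).-tuple S, independent_mod (saturation s) t.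
Proof.
pose V := [set y i 0%N | i : 'I_s].
have cardV : #|~: V| = (N - s)%N.
  rewrite cardsCs setCK card_ord card_imset ?card_ord // => i j.
  by case/(y_inj (ltn_ord i) g_gt0 (ltn_ord j) g_gt0) => /val_inj.
rewrite -cardV; exists [tuple 'X_(enum_val i) | i < #|~: V|] => p.
set t := [tuple 'X_(enum_val i) | i < #|~: V|] => /saturationP e0.
have {e0} : p \mPo t = 0.
  apply/eqP; rewrite -tofrac_eq0 -(e0 (leqnn s)); apply/eqP.
  elim/mpoly_rect_ring: p {e0} => [c|i|p q ep eq|p q ep eq].
  - by rewrite comp_mpolyC /solve mmapC.
  - rewrite comp_mpolyXU -tnth_nth tnth_mktuple solveX /solution.
    case: pickP => // j /eqP ej; have := enum_valP i; rewrite inE.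
    by rewrite ej imset_f.
  - by rewrite !rmorphD /= ep eq.
  - by rewrite !rmorphM /= ep eq.
move=> pt0.
pose t' : N.-tuple {mpoly K[#|~: V|]} :=
  [tuple if [pick i | enum_val i == v] is Some i then 'X_i else 0 | v < N].
rewrite -[p]comp_mpoly_id.
have <- : (p \mPo t) \mPo t' = p \mPo [tuple 'X_i | i < #|~: V|].
  rewrite comp_mpolyA; apply: eq_comp_mpoly => i; rewrite !tnth_mktuple.
  rewrite comp_mpolyXU -tnth_nth tnth_mktuple; case: pickP => [j /eqP/enum_val_inj->//|].
  by move/(_ i); rewrite eqxx.
by rewrite pt0 comp_mpoly0.
Qed.

Lemma saturation_height : (s <= N)%N -> prime_height (saturation s) s.
Proof.
move=> le_sN; split; first exact: saturation_chain.
have [t ind_t] := saturation_independent.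
by move=> h /(prime_chain_leq ind_t); lia.
Qed.

End Saturation.
End GenericForms.

(** * Initial terms *)

Section InitialTerms.
Variables (K : fieldType) (n s g : nat).
Local Notation N := (n + s * g)%N.
Local Notation S := {mpoly K[N]}.
Implicit Types (m : 'X_{1..N}) (mu : 'X_{1..n}) (p : {mpoly K[n]}).

Definition Yvar (i : 'I_s) (j : 'I_g) : 'I_N := rshift n (mxvec_index i j).

Lemma Yvar_inj i j i' j' : Yvar i j = Yvar i' j' -> i = i' /\ j = j'.
Proof.
by move/rshift_inj/cast_ord_inj/enum_rank_inj => -[-> ->].
Qed.

Lemma eq_Yvar i j i' j' : (Yvar i j == Yvar i' j') = (i == i') && (j == j').
Proof.
by apply/eqP/andP => [/Yvar_inj[-> ->]|[/eqP-> /eqP->]].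
Qed.

Variant var_spec : 'I_N -> Prop :=
  | XVar i : var_spec (lshift (s * g) i)
  | YVar i j : var_spec (Yvar i j).

Lemma varP v : var_spec v.
Proof.
by case: (split_ordP v) => [i|k] ->; [left | case/mxvec_indexP: k => i j; right].
Qed.

Definition xpart m : 'X_{1..n} := [multinom m (lshift (s * g) i) | i < n].

Definition embed_mnm mu : 'X_{1..N} :=
  (\sum_i U_(lshift (s * g) i) *+ mu i)%MM.

Lemma embed_mnm_x mu i : embed_mnm mu (lshift (s * g) i) = mu i.
Proof.
rewrite mnm_sumE (bigD1 i) //= big1 => [|j ne_ji].
  by rewrite mulmnE mnm1E eqxx mul1n addn0.
by rewrite mulmnE mnm1E (inj_eq (@lshift_inj _ _)) (negPf ne_ji).
Qed.

Lemma embed_mnm_y mu i j : embed_mnm mu (Yvar i j) = 0%N.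
Proof. by rewrite mnm_sumE big1 // => k _; rewrite mulmnE mnm1E eq_lrshift. Qed.

Lemma xpart_embed mu : xpart (embed_mnm mu) = mu.
Proof. by apply/mnmP => i; rewrite mnmE embed_mnm_x. Qed.

Lemma xpartD m m' : xpart (m + m') = (xpart m + xpart m')%MM.
Proof. by apply/mnmP => i; rewrite mnmDE !mnmE. Qed.

Lemma xpart_Y i j : xpart U_(Yvar i j) = 0%MM.
Proof. by apply/mnmP => k; rewrite mnmE mnm1E mnm0E eq_rlshift. Qed.

Lemma to_RYE p :
  to_RY s g p = \sum_(mu <- msupp p) p@_mu *: 'X_[embed_mnm mu].
Proof.
rewrite /to_RY comp_mpolyEX; apply: eq_bigr => mu _; congr (_ *: _).
rewrite comp_mpolyX -mprodXnE; apply: eq_bigr => i _.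
by rewrite tnth_mktuple.
Qed.

Lemma mcoeff_to_RY p mu : (to_RY s g p)@_(embed_mnm mu) = p@_mu.
Proof.
rewrite to_RYE {3}[p]mpolyE !raddf_sum /=; apply: eq_bigr => nu _.
rewrite !mcoeffZ !mcoeffX; congr (_ * (_ : bool)%:R).
by apply/eqP/eqP => [/(congr1 xpart)|->//]; rewrite !xpart_embed.
Qed.

Lemma msupp_to_RY p m :
  m \in msupp (to_RY s g p) -> exists2 mu, mu \in msupp p & m = embed_mnm mu.
Proof.
rewrite mcoeff_msupp to_RYE raddf_sum /= => nz.
have [|/hasPn none] := boolP (has (fun mu => m == embed_mnm mu) (msupp p)).
  by case/hasP => mu mu_in /eqP em; exists mu.
case/negP: nz; rewrite big_seq big1 // => mu /none; rewrite mcoeffZ mcoeffX eq_sym.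
by move/negPf->; rewrite mulr0.
Qed.

(* In row [i] the weight is largest at column [i + 1]; as a function of
   [(i, j)] it is strictly supermodular, so the diagonal term is the heaviest
   one of every minor. *)
Definition weight (i : 'I_s) (j : 'I_g) : nat := (i.+1 * j * 2 + (g ^ 2 - j ^ 2))%N.

Definition mweight m : nat := (\sum_i \sum_j weight i j * m (Yvar i j))%N.

Lemma mweightD m m' : mweight (m + m') = (mweight m + mweight m')%N.
Proof.
rewrite /mweight -big_split; apply: eq_bigr => i _ /=.
by rewrite -big_split; apply: eq_bigr => j _ /=; rewrite mnmDE mulnDr.
Qed.

Lemma mweight0 : mweight 0%MM = 0%N.
Proof.
by rewrite /mweight big1 // => i _; rewrite big1 // => j _; rewrite mnm0E muln0.
Qed.

Lemma mweight_sum (T : Type) (r : seq T) (F : T -> 'X_{1..N}) :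
  mweight (\sum_(i <- r) F i)%MM = (\sum_(i <- r) mweight (F i))%N.
Proof. by apply: (big_morph _ mweightD mweight0). Qed.

Lemma mweight_Y i j : mweight U_(Yvar i j) = weight i j.
Proof.
rewrite /mweight (bigD1 i) //= [X in (_ + X)%N]big1 => [|i' ne]; last first.
  by rewrite big1 // => j' _; rewrite mnm1E eq_Yvar eq_sym (negPf ne) muln0.
rewrite addn0 (bigD1 j) //= big1 => [|j' ne].
  by rewrite mnm1E eqxx muln1 addn0.
by rewrite mnm1E eq_Yvar eqxx eq_sym (negPf ne) muln0.
Qed.

Lemma mweight_embed mu : mweight (embed_mnm mu) = 0%N.
Proof.
by rewrite /mweight big1 // => i _; rewrite big1 // => j _; rewrite embed_mnm_y muln0.
Qed.

Variable le : rel 'X_{1..n}.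
Hypothesis le_order : term_order le.

(** After the weight, [le] on the [x] part preserves the given initial monomials of [alpha]; [<=] on
    whole monomials breaks the remaining ties. *)
Definition extended_order : rel 'X_{1..N} := fun m m' =>
  (mweight m < mweight m')%N || (mweight m == mweight m') &&
    (if xpart m == xpart m' then (m <= m')%O else le (xpart m) (xpart m')).

Lemma extended_order_refl m : extended_order m m.
Proof. by rewrite /extended_order !eqxx lexx orbT. Qed.

Lemma extended_order_term : term_order extended_order.
Proof.
have [le_tot le_anti le_tr le_0 le_add] := le_order.
rewrite /extended_order; split.
- move=> m m'; case: ltngtP => //= _; rewrite eq_sym; case: eqP => // _.
  exact: le_total.
- move=> m m' /andP[]; case: ltngtP => //= _; rewrite eq_sym.
  case: eqP => [_ h1 h2|ne h1 h2]; first by apply/eqP; rewrite eq_le h1.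
  by case: ne; apply: le_anti; rewrite h1 h2.
- move=> m2 m1 m3; case: (ltngtP (mweight m1)) => //= [lt12 _|-> ].
    by case: ltngtP => //= [lt23 _|<-]; rewrite ?lt12 // (ltn_trans lt12 lt23).
  move=> h1; case: ltngtP => //= _; move: h1.
  case: eqP => [->|ne12] h1; case: eqP => [e23|ne23] h2.
  + exact: le_trans h2.
  + by [].
  + by rewrite -e23; case: eqP.
  case: eqP => [e13|_]; last exact: le_tr h2.
  by case: ne12; apply: le_anti; rewrite h1 e13 h2.
- move=> m; rewrite mweight0; case: ltngtP => //= _.
  case: eqP => [_|_]; first exact: le0m.
  have -> : xpart 0%MM = 0%MM by apply/mnmP => i; rewrite mnmE !mnm0E.
  exact: le_0.
move=> m1 m2 m; rewrite !mweightD ltn_add2r eqn_add2r !xpartD eqm_add2r.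
case/orP => [->//|/andP[-> h]]; apply/orP; right => /=.
by move: h; case: eqP => _; [rewrite lemc_add2l | apply: le_add].
Qed.

(** * Initial terms of the linear forms *)

Section RowForms.
Variables (alpha : 'I_g -> {mpoly K[n]}) (top : 'I_g -> 'X_{1..n}).
Hypothesis top_alpha : forall j, is_initial le (alpha j) (top j).

Lemma YalphaE i :
  Yalpha s alpha i 0 = \sum_j 'X_(Yvar i j) * to_RY s g (alpha j).
Proof. by rewrite /Yalpha mxE; apply: eq_bigr => j _; rewrite !mxE. Qed.

(** Distinct columns carry distinct [Y] variables, so nothing cancels; the weight selects column
    [i + 1], and [le] decides within it. *)
Lemma Yalpha_initial (i : 'I_s) (j : 'I_g) : j = i.+1 :> nat ->
  is_initial extended_order (Yalpha s alpha i 0) (U_(Yvar i j) + embed_mnm (top j))%MM.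
Proof.
move=> ej; rewrite YalphaE.
have [top_in top_max] := top_alpha j.
have suppY k m : m \in msupp ('X_(Yvar i k) * to_RY s g (alpha k)) ->
    exists2 mu, mu \in msupp (alpha k) & m = (U_(Yvar i k) + embed_mnm mu)%MM.
  rewrite mulrC (perm_mem (msuppMX _ _)) => /mapP[m' /msupp_to_RY[mu mu_in ->] ->].
  by exists mu.
split.
  rewrite mcoeff_msupp raddf_sum (bigD1 j) //= big1 ?addr0 => [|k ne_kj].
    by rewrite mulrC mcoeffMX mcoeff_to_RY -mcoeff_msupp.
  apply: memN_msupp_eq0; apply/negP => /suppY[mu _ /mnmP/(_ (Yvar i k))].
  by rewrite !mnmDE !embed_mnm_y !mnm1E !eq_Yvar !eqxx eq_sym (negPf ne_kj).
move=> m; rewrite mcoeff_msupp raddf_sum /= => nz.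
have [/existsP[k]|/existsPn none] :=
  boolP [exists k, m \in msupp ('X_(Yvar i k) * to_RY s g (alpha k))]; last first.
  by case/negP: nz; rewrite big1 // => k _; apply: memN_msupp_eq0.
case/suppY => mu mu_in ->; rewrite /extended_order !mweightD !mweight_Y.
rewrite !mweight_embed !addn0 !xpartD !xpart_Y !xpart_embed !add0m.
have [ekj|ne_kj] := eqVneq k j.
  subst k; rewrite eqxx ltnn /=; case: eqP => [->|_]; first exact: lexx.
  exact: top_max.
have ne : (k : nat) != i.+1 by rewrite -ej.
suff -> : (weight i k < weight i j)%N by [].
rewrite /weight ej; have lt_k := ltn_ord k; have lt_j := ltn_ord j; rewrite ej in lt_j.
(* Completing the square, [weight i k] is [g^2 + (i+1)^2 - (k - (i+1))^2], maximal only at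
   [k = i + 1]. *)
have [] := nat_Cauchy k i.+1; rewrite -mulnn => /= h1; rewrite (negPf ne).
nia.
Qed.

End RowForms.

(** * Initial terms of the maximal minors *)

Section Minors.
Variable (rho : 'I_g -> 'I_s) (k : nat).
Hypothesis rhoE : forall q, rho q = (k + q)%N :> nat.

Definition minor : S := \det (\matrix_(q, j) Ymx n K s g (rho q) j).

Definition minor_mnm (sigma : {perm 'I_g}) : 'X_{1..N} :=
  (\sum_q U_(Yvar (rho q) (sigma q)))%MM.

Lemma minorE : minor = \sum_(sigma : {perm 'I_g}) (-1) ^+ sigma *: 'X_[minor_mnm sigma].
Proof.
apply: eq_bigr => sigma _.
rewrite -mul_mpolyC rmorphXn rmorphN1; congr (_ * _).
rewrite -mprodXE; apply: eq_bigr => q _.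
by rewrite !mxE.
Qed.

(** A rearrangement inequality: the weight depends on [sigma] only through the sum of the
    [q * sigma q], and summing [2 q sigma(q) <= q^2 + sigma(q)^2] makes the identity the unique
    maximizer. *)
Lemma mweight_minor_mnm (sigma : {perm 'I_g}) : sigma != 1%g ->
  (mweight (minor_mnm sigma) < mweight (minor_mnm 1))%N.
Proof.
move=> ne; rewrite !mweight_sum.
have mw (tau : {perm 'I_g}) : (\sum_q mweight U_(Yvar (rho q) (tau q)) =
    k.+1 * 2 * (\sum_(q < g) q) + 2 * (\sum_(q < g) q * tau q)
    + \sum_(q < g) (g ^ 2 - q ^ 2))%N.
  have -> : (\sum_(q < g) q = \sum_(q < g) tau q)%N.
    exact: (reindex_inj (@perm_inj _ tau)).
  have -> : (\sum_(q < g) (g ^ 2 - q ^ 2) = \sum_(q < g) (g ^ 2 - tau q ^ 2))%N.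
    exact: (reindex_inj (@perm_inj _ tau)).
  rewrite !big_distrr /= -!big_split; apply: eq_bigr => q _ /=.
  by rewrite mweight_Y /weight rhoE; lia.
rewrite !mw ltn_add2r ltn_add2l ltn_mul2l /=.
have le2 (q : 'I_g) : (2 * (q * sigma q) <= q ^ 2 + sigma q ^ 2 ?= iff (sigma q == q))%N.
  by rewrite eq_sym -(inj_eq val_inj); apply: nat_Cauchy.
have e2 : (\sum_(q < g) q ^ 2 = \sum_(q < g) sigma q ^ 2)%N.
  exact: (reindex_inj (@perm_inj _ sigma)).
have [le_s eq_s] : (\sum_(q < g) 2 * (q * sigma q)
    <= \sum_(q < g) q ^ 2 + \sum_(q < g) q ^ 2 ?= iff [forall q, sigma q == q])%N.
  by rewrite {2}e2 -big_split; apply: leqif_sum => q _; apply: le2.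
have lt_s : (\sum_(q < g) 2 * (q * sigma q) < \sum_(q < g) q ^ 2 + \sum_(q < g) q ^ 2)%N.
  rewrite ltn_neqAle le_s andbT eq_s; apply: contra ne => /forallP e.
  by apply/eqP/permP => q; rewrite perm1; apply/eqP; apply: e.
rewrite -big_distrr /= addnn -mul2n ltn_mul2l /= in lt_s.
by apply: leq_trans lt_s _; apply: leq_sum => q _; rewrite perm1 mulnn.
Qed.

Lemma minor_initial : is_initial extended_order minor (minor_mnm 1).
Proof.
split.
  rewrite mcoeff_msupp minorE raddf_sum (bigD1 1%g) //= big1 => [|sigma ne].
    by rewrite addr0 mcoeffZ mcoeffX eqxx odd_perm1 mulr1 oner_eq0.
  rewrite mcoeffZ mcoeffX; case: eqP => [e|_]; last by rewrite mulr0.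
  by have := mweight_minor_mnm ne; rewrite e ltnn.
move=> m; rewrite mcoeff_msupp minorE raddf_sum /= => nz.
have [/existsP[sigma /eqP->]|/existsPn none] :=
  boolP [exists sigma, m == minor_mnm sigma]; last first.
  case/negP: nz; rewrite big1 // => sigma _; rewrite mcoeffZ mcoeffX eq_sym.
  by rewrite (negPf (none _)) mulr0.
have [->|ne] := eqVneq sigma 1%g; first exact: extended_order_refl.
by rewrite /extended_order mweight_minor_mnm.
Qed.

End Minors.
End InitialTerms.

(** * The generic residual intersection *)

Section PrimeTransport.
Variable R : comNzRingType.
Implicit Types P Q I : R -> Prop.

Lemma eq_prime_chain P Q h :
  (forall x, P x <-> Q x) -> prime_chain P h -> prime_chain Q h.
Proof.
by move=> ePQ [C [prC ltC CP]]; exists C; split=> // x; rewrite CP ePQ.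
Qed.

Lemma eq_prime_height P Q h :
  (forall x, P x <-> Q x) -> prime_height P h -> prime_height Q h.
Proof.
move=> ePQ [cP maxP]; split; first exact: eq_prime_chain cP.
by move=> k cQ; apply: maxP; apply: eq_prime_chain cQ => x; rewrite ePQ.
Qed.

Lemma eq_is_prime P Q : (forall x, P x <-> Q x) -> is_prime P -> is_prime Q.
Proof.
move=> ePQ [[P0 PD PM] P1 prP]; split; first split.
- exact/ePQ.
- by move=> x y /ePQ Px /ePQ Py; apply/ePQ/PD.
- by move=> a x /ePQ Px; apply/ePQ/PM.
- by move/ePQ.
- by move=> x y /ePQ/prP[] /ePQ; [left | right].
Qed.

(** For [f] outside the prime [P] the colon [P : f] is [P], so [P] is its own only associated
    prime. *)
Lemma prime_unmixed P h : is_prime P -> prime_height P h -> unmixed P.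
Proof.
move=> [iP P1 prP] hP; exists h => Q [[_ Q1 _] [f Qf]].
have nPf : ~ P f by move=> Pf; apply: Q1; apply/Qf; rewrite mul1r.
apply: eq_prime_height hP => x; rewrite Qf; split; first exact: in_idealMr.
by case/prP.
Qed.

Lemma prime_chain_above P Q h : (0 < h)%N ->
  is_prime Q -> ideal_sub P Q -> prime_chain P h -> prime_chain Q h.
Proof.
move=> h_gt0 prQ sPQ cP; have [sQP|nsQP] := classic (ideal_sub Q P).
  by apply: eq_prime_chain cP => x; split; [apply: sPQ | apply: sQP].
case: cP => C [prC ltC CP].
(* The bottom prime is dropped and [Q] is put on top, so the length stays [h]. *)
exists (fun i => if (i < h)%N then C i.+1 else Q); split.
- by move=> i _; case: ifP => // lt_ih; apply: prC.
- move=> i lt_ih; rewrite lt_ih; case: ltnP => [lt_h|le_h]; first exact: ltC.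
  have -> : i.+1 = h by apply/eqP; rewrite eqn_leq lt_ih le_h.
  by split=> [x /CP/sPQ//|sub]; apply: nsQP => x /sub/CP.
- by rewrite ltnn.
Qed.

Lemma prime_ideal_height P h : (0 < h)%N ->
  is_prime P -> prime_height P h -> ideal_height P h.
Proof.
move=> h_gt0 prP hP; split; first by exists P; split=> // x.
by move=> Q prQ sPQ; apply: prime_chain_above (hP.1).
Qed.

End PrimeTransport.

Section GenericResidualIntersection.
Variables (K : fieldType) (n g s d : nat) (alpha : 'I_g -> {mpoly K[n]}).
Hypotheses (g_gt0 : (0 < g)%N) (le_gs : (g <= s)%N).
Hypothesis hom_alpha : forall i, alpha i \is d.-homog.
Hypothesis reg_alpha : regular_sequence alpha.

Local Notation N := (n + s * g)%N.
Local Notation S := {mpoly K[N]}.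
Local Notation J := (generic_RI s alpha).

Let j0 : 'I_g := Ordinal g_gt0.
Let i0 : 'I_s := Ordinal (leq_trans g_gt0 le_gs).
Let x : 'I_n -> 'I_N := fun i => lshift (s * g) i.
(** The defaults [i0] and [j0] only serve indices out of range. *)
Let y (i m : nat) : 'I_N := Yvar n (insubd i0 i) (insubd j0 m).
Let a (m : nat) := alpha (insubd j0 m).

Let x_inj : injective x. Proof. exact: lshift_inj. Qed.

Let x_neq_y i j m : x i != y j m. Proof. by rewrite eq_lrshift. Qed.

Let y_inj i m i' m' : (i < s)%N -> (m < g)%N -> (i' < s)%N -> (m' < g)%N ->
  y i m = y i' m' -> i = i' /\ m = m'.
Proof.
move=> lt_i lt_m lt_i' lt_m' /Yvar_inj[/(congr1 val) ei /(congr1 val) em].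
by rewrite !val_insubd lt_i lt_i' in ei; rewrite !val_insubd lt_m lt_m' in em.
Qed.

Let reg_a r p : (r < g)%N ->
  adjoins (fun z => z = 0) a r (p * a r) -> adjoins (fun z => z = 0) a r p.
Proof.
move=> lt_rg /ideal_gen_adjoins-/(_ (ltnW lt_rg)) Ap.
apply/ideal_gen_adjoins; first exact: ltnW.
apply: (reg_alpha.2 (Ordinal lt_rg)); congr (ideal_gen _ _ (_ * alpha _)): Ap.
by apply: val_inj; rewrite val_insubd lt_rg.
Qed.

Let a0_neq0 : a 0%N != 0.
Proof.
apply/eqP => a0; case: reg_alpha => nI _; apply: nI.
apply/(ideal_gen_predT_adjoins j0).
(* With [a 0 = 0], regularity at [r = 0] applied to [1] would give [1 = 0]. *)
have : adjoins (fun z => z = 0) a 0 1 by apply: reg_a; rewrite ?mul1r.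
by move/eqP; rewrite oner_eq0.
Qed.

Let b (m : nat) : S := inject_x x (a m).

Let hom_b m : b m \is d.-homog.
Proof. by apply: inject_x_homog => k; apply: hom_alpha. Qed.

Let YalphaE' i : Yalpha s alpha (insubd i0 i) 0 = partial_form b (y i) g.
Proof.
by rewrite YalphaE; apply: eq_bigr => j _; rewrite /y /b /a !valKd.
Qed.

Let sat := saturation g x y a s.

(** Multiplying an element of the colon ideal by [alpha j0] gives the exponent [1]; the converse is
    [saturation_colon]. *)
Lemma generic_RI_saturation p : J p <-> sat p.
Proof.
split=> [Jp|sat_p].
  exists 1%N; rewrite expr1 mulrC.
  have /Jp/(ideal_gen_predT_adjoins i0) :
      ideal_gen predT (fun j => to_RY s g (alpha j)) (to_RY s g (alpha j0)).
    exact: (@ideal_gen_mem _ _ predT (fun j => to_RY s g (alpha j))).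
  have -> : to_RY s g (alpha j0) = b 0%N.
    by rewrite /b /a -[0%N]/(val j0) valKd.
  by apply: eq_adjoins => i _; rewrite YalphaE'.
pose B z := ideal_gen predT (fun i : 'I_s => Yalpha s alpha i 0) (p * z).
have iY := ideal_gen_ideal predT (fun i : 'I_s => Yalpha s alpha i 0).
apply: (ideal_gen_min (A := B)) => [|j _].
  rewrite /B; split=> [|z z' Bz Bz'|c z Bz]; first by rewrite mulr0; apply: in_ideal0.
    by rewrite mulrDr; apply: in_idealD.
  by rewrite mulrCA; apply: in_idealM.
apply/(ideal_gen_predT_adjoins i0).
have := saturation_colon g_gt0 x_inj x_neq_y y_inj (fun m => hom_alpha _)
  reg_a (ltn_ord j) sat_p.
have -> : inject_x x (a j) = to_RY s g (alpha j).
  by rewrite /a valKd.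
by apply: eq_adjoins => i _; rewrite YalphaE'.
Qed.

Lemma generic_RI_prime : is_prime J.
Proof.
apply: eq_is_prime (saturation_prime g_gt0 x_inj x_neq_y y_inj a0_neq0 (leqnn s)).
by move=> p; rewrite generic_RI_saturation.
Qed.

Lemma generic_RI_height : prime_height J s.
Proof.
have le_sN : (s <= N)%N.
  by apply: leq_trans (leq_addl n _); rewrite -[X in (X <= _)%N]muln1 leq_mul.
apply: eq_prime_height
  (saturation_height g_gt0 x_inj x_neq_y y_inj a0_neq0 le_sN).
by move=> p; rewrite generic_RI_saturation.
Qed.

(** Read on the saturation: multiplying by the homogeneous [b 0 ^+ e] only shifts components, and
    the row ideal is homogeneous. *)
Lemma generic_RI_homogeneous : homogeneous_ideal J.
Proof.
move=> p /generic_RI_saturation[e Ae] k; apply/generic_RI_saturation; exists e.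
have hb : inject_x x (a 0%N) ^+ e \is (d * e).-homog.
  by apply: dhomogMn; apply: hom_b.
rewrite mulrC -(pihomogM_homog _ _ hb).
have hL : homogeneous_ideal (adjoins (fun z => z = 0)
    (fun i => partial_form b (y i) g) s).
  apply: (homogeneous_adjoins (d := d.+1)); first exact: zero_ideal.
    exact: homogeneous_zero.
  by move=> i; apply: partial_form_homog.
by apply: hL; rewrite mulrC.
Qed.

End GenericResidualIntersection.

(** * The elements witnessing property P *)

Section Witnesses.
Variables (K : fieldType) (n g s : nat) (alpha : 'I_g -> {mpoly K[n]}).
Local Notation N := (n + s * g)%N.
Local Notation S := {mpoly K[N]}.
Local Notation J := (generic_RI s alpha).

Lemma Yalpha_in_RI i : J (Yalpha s alpha i 0).
Proof.
move=> z _; apply: in_idealMr; first exact: ideal_gen_ideal.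
exact: (@ideal_gen_mem _ _ predT (fun i : 'I_s => Yalpha s alpha i 0)).
Qed.

(* Cramer: [adj A *m (A *m alpha) = det A *: alpha]. *)
Lemma minor_in_RI (rho : 'I_g -> 'I_s) : J (minor K n rho).
Proof.
have iY := ideal_gen_ideal predT (fun i : 'I_s => Yalpha s alpha i 0).
pose B z := ideal_gen predT (fun i : 'I_s => Yalpha s alpha i 0) (minor K n rho * z).
apply: (ideal_gen_min (A := B)) => [|j _].
  rewrite /B; split=> [|z z' Bz Bz'|c z Bz]; first by rewrite mulr0; apply: in_ideal0.
    by rewrite mulrDr; apply: in_idealD.
  by rewrite mulrCA; apply: in_idealM.
rewrite /B /minor; set A := (X in \det X).
pose v : 'cV[S]_g := \col_j to_RY s g (alpha j).
have -> : \det A * to_RY s g (alpha j) = (\adj A *m (A *m v)) j 0.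
  by rewrite mulmxA mul_adj_mx mul_scalar_mx !mxE.
rewrite mxE; apply: ideal_sum => // q _; apply: in_idealM => //.
have -> : (A *m v) q 0 = Yalpha s alpha (rho q) 0.
  by rewrite !mxE; apply: eq_bigr => k _; rewrite !mxE.
exact: (@ideal_gen_mem _ _ predT (fun i : 'I_s => Yalpha s alpha i 0)).
Qed.

Lemma Yalpha_homog d i :
  (forall j, alpha j \is d.-homog) -> Yalpha s alpha i 0 \is d.+1.-homog.
Proof.
move=> hom_alpha; rewrite YalphaE; apply: rpred_sum => j _; rewrite -add1n.
apply: dhomogM; first by rewrite dhomogX /= mdeg1.
exact: (inject_x_homog (a := fun=> alpha j) (@lshift n (s * g)) (fun=> hom_alpha j) 0).
Qed.

Variables (le : rel 'X_{1..n}) (top : 'I_g -> 'X_{1..n}).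
Hypothesis g_gt0 : (0 < g)%N.
Hypothesis top_alpha : forall j, is_initial le (alpha j) (top j).
Hypothesis sqfree_top : forall j, squarefree_mnm (top j).
Hypothesis coprime_top : forall i j, i != j -> coprime_mnm (top i) (top j).

(** For [g <= i.+1], the [g] consecutive rows ending at row [i]. Thus ['I_s] indexes all witnesses:
    the first [g - 1] indices give forms, the other [s - g + 1] give minors. *)
Definition witness_rows (i : 'I_s) (q : 'I_g) : 'I_s := insubd i (i - g.-1 + q)%N.

Lemma witness_rowsE (i : 'I_s) q :
  (g <= i.+1)%N -> witness_rows i q = (i - g.-1 + q)%N :> nat.
Proof.
move=> le_gi; rewrite /witness_rows val_insubd ifT //.
by have := ltn_ord i; have := ltn_ord q; lia.
Qed.

Definition next_col (i : 'I_s) : 'I_g := insubd (Ordinal g_gt0) i.+1.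

Lemma next_colE (i : 'I_s) : (i.+1 < g)%N -> next_col i = i.+1 :> nat.
Proof. by move=> lt_ig; rewrite /next_col val_insubd lt_ig. Qed.

Definition witness (i : 'I_s) : S :=
  if (i.+1 < g)%N then Yalpha s alpha i 0 else minor K n (witness_rows i).

Definition witness_mnm (i : 'I_s) : 'X_{1..N} :=
  if (i.+1 < g)%N
  then (U_(Yvar n i (next_col i)) + embed_mnm s g (top (next_col i)))%MM
  else minor_mnm n (witness_rows i) 1.

Lemma witness_initial i : is_initial (extended_order le) (witness i) (witness_mnm i).
Proof.
rewrite /witness /witness_mnm; case: ltnP => [lt_ig|le_gi].
  by apply: Yalpha_initial => //; apply: next_colE.
by apply: minor_initial => q; apply: witness_rowsE.
Qed.

Lemma witness_mnm_x i k : witness_mnm i (lshift (s * g) k) =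
  if (i.+1 < g)%N then top (next_col i) k else 0%N.
Proof.
rewrite /witness_mnm; case: ifP => _.
  by rewrite mnmDE mnm1E eq_rlshift embed_mnm_x.
by rewrite mnm_sumE big1 // => q _; rewrite mnm1E eq_rlshift.
Qed.

Lemma witness_mnm_y i r c : witness_mnm i (Yvar n r c) =
  if (i.+1 < g)%N then (i == r) && (next_col i == c) : nat
  else (witness_rows i c == r).
Proof.
rewrite /witness_mnm; case: ifP => _.
  by rewrite mnmDE mnm1E embed_mnm_y eq_Yvar addn0.
rewrite mnm_sumE (bigD1 c) //= big1 => [|q ne_qc].
  by rewrite mnm1E eq_Yvar perm1 eqxx andbT addn0.
by rewrite mnm1E eq_Yvar perm1 (negPf ne_qc) andbF.
Qed.

Lemma witness_squarefree i : squarefree_mnm (witness_mnm i).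
Proof.
move=> v; case: (varP v) => [k|r c].
  by rewrite witness_mnm_x; case: ifP => // _; apply: sqfree_top.
by rewrite witness_mnm_y; case: ifP => _; apply: leq_b1.
Qed.

(** The [Y] variables are told apart by row minus column: it is [-1] for the forms and
    [i - (g-1) >= 0] for the minor ending at row [i]. Two forms use different rows, and their [x]
    parts are coprime by hypothesis. *)
Lemma witness_coprime i j :
  i != j -> coprime_mnm (witness_mnm i) (witness_mnm j).
Proof.
move=> ne_ij v; case: (varP v) => [k|r c].
  rewrite !witness_mnm_x; case: ltnP => [lt_ig|_]; last by left.
  case: ltnP => [lt_jg|_]; last by right.
  apply: coprime_top; apply: contra ne_ij => /eqP/(congr1 val).
  by rewrite /= !next_colE // => -[/val_inj->].
rewrite !witness_mnm_y.
case: ltnP => [lt_ig|le_gi]; case: ltnP => [lt_jg|le_gj].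
- have [<-|_] := eqVneq i r; last by left.
  by right; rewrite eq_sym (negPf ne_ij).
- have [<-|_] := eqVneq i r; last by left.
  have [ec|_] := eqVneq (next_col i) c; last by left.
  right; case: eqP => // /(congr1 val); rewrite /= witness_rowsE // -ec next_colE //.
  by lia.
- have [<-|_] := eqVneq j r; last by right.
  have [ec|_] := eqVneq (next_col j) c; last by right.
  left; case: eqP => // /(congr1 val); rewrite /= witness_rowsE // -ec next_colE //.
  by lia.
have [<-|_] := eqVneq (witness_rows i c) r; last by left.
right; case: eqP => // /(congr1 val); rewrite /= !witness_rowsE // => e.
by case/eqP: ne_ij; apply: val_inj => /=; lia.
Qed.

Lemma witness_homog d i :
  (forall j, alpha j \is d.-homog) -> exists e, witness i \is e.-homog.
Proof.
move=> hom_alpha.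
rewrite /witness; case: ifP => _; first by exists d.+1; apply: Yalpha_homog.
exists g; rewrite minorE; apply: rpred_sum => sigma _; apply: rpredZ.
rewrite dhomogX /= mdeg_sum (eq_bigr (fun=> 1%N)) => [|q _]; last exact: mdeg1.
by rewrite sum_nat_const card_ord muln1.
Qed.

Lemma witness_in_RI i : J (witness i).
Proof.
by rewrite /witness; case: ifP => _; [apply: Yalpha_in_RI | apply: minor_in_RI].
Qed.

End Witnesses.

Theorem theorem5p4 (K : fieldType) (n g : nat) (hg : (0 < g)%N)
    (alpha : 'I_g -> {mpoly K[n]}) (d : nat)
    (hom_alpha : forall i, alpha i \is d.-homog)
    (reg_alpha : regular_sequence alpha)
    (P_alpha : property_P_seq alpha)
    (s : nat) (hs : (g <= s)%N) :
  property_P (generic_RI s alpha).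
Proof.
have prJ := generic_RI_prime hg hs hom_alpha reg_alpha.
have hJ := generic_RI_height hg hs hom_alpha reg_alpha.
have [le [le_order [top [top_alpha sqfree_top coprime_top]]]] := P_alpha.
split; first by case: prJ.
- exact: generic_RI_homogeneous hg hs hom_alpha reg_alpha.
- exact: prime_unmixed prJ hJ.
exists (extended_order le); split; first exact: extended_order_term.
exists s; split; first exact: prime_ideal_height (leq_trans hg hs) prJ hJ.
exists (witness alpha); split.
- exact: witness_in_RI.
- by move=> i; apply: witness_homog hom_alpha.
exists (witness_mnm top hg); split.
- exact: witness_initial.
- exact: witness_squarefree.
- exact: witness_coprime.
Qed.
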